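(* Let $F$ be a field, let $k,l\ge 1$, and let $\mathcal V_1,\dots,\mathcal V_k$ and $\mathcal V'_1,\dots,\mathcal V'_l$ be varieties of group representations over $F$. Put $\mathcal V=\mathcal V_1\cdots\mathcal V_k$ and $\mathcal V'=\mathcal V'_1\cdots\mathcal V'_l$ (products of varieties of group representations). Then $\mathcal V\subseteq\mathcal V'$ if and only if there exist a variety $\mathcal W$ of group representations over $F$ and varieties $\mathcal W_1,\dots,\mathcal W_k,\mathcal W'_1,\dots,\mathcal W'_l$ of group representations over $F$ such that $$\mathcal W=\mathcal W_1\cdots\mathcal W_k=\mathcal W'_1\cdots\mathcal W'_l,$$ $$\mathcal V_1\subseteq\mathcal W_1,\ \dots,\ \mathcal V_k\subseteq\mathcal W_k\quad\text{and}\quad \mathcal W'_1\subseteq\mathcal V'_1,\ \dots,\ \mathcal W'_l\subseteq\mathcal V'_l.$$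
   Context: A group representation over $F$ is a (right) $FH$-module $M$ for some group $H$ (the group $H$ may vary), where $FH$ denotes the group algebra. Let $G$ be the free group on a countably infinite set of free generators $X=\{x_1,x_2,\dots\}$ and let $f\in FG$. An $FH$-module $M$ satisfies the identity $f=0$ if $a\,\bar\mu(f)=0$ for every $a\in M$ and every group homomorphism $\mu:G\to H$, where $\bar\mu:FG\to FH$ is the $F$-algebra homomorphism induced by $\mu$. A variety of group representations over $F$ is the class of all group representations over $F$ (modules over group algebras $FH$ of arbitrary groups $H$) satisfying some given set of identities $f=0$ with $f\in FG$. The product $\mathcal U\mathcal V$ of two such varieties is the variety consisting of all $FH$-modules $M$ ($H$ any group) having an $FH$-submodule $N$ such that $N\in\mathcal U$ and $M/N\in\mathcal V$. This multiplication is associative, so products of several varieties are well defined. *)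

(* Defs.v *)
From HB Require Import structures.
From mathcomp Require Import all_boot all_algebra.
From mathcomp Require Import finmap.
From mathcomp.multinomials Require Import monalg.

Set Implicit Arguments.
Unset Strict Implicit.
Unset Printing Implicit Defensive.

Import GRing.Theory.

Local Open Scope ring_scope.

(* The free group on X is realised as the set of reduced words in the letters
   (x, false), standing for x, and (x, true), standing for x^-1; fg_lift,
   fg_lift_gen and fg_lift_unique are its universal property.                 *)
Section FreeGroup.
Variable X : choiceType.

Definition letter : choiceType := (X * bool)%type.
Implicit Types (a b : letter) (s t u w : seq letter).

Definition linv a : letter := (a.1, ~~ a.2).

Definition reduced s := sorted (fun a b => b != linv a) s.

(* [lpush a s] is the reduced form of [a :: s] when s is reduced. *)
Definition lpush a s :=
  if s is b :: s' then if b == linv a then s' else a :: s else [:: a].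

Definition wmul s t := foldr lpush t s.
Definition winv s := rev (map linv s).

Lemma linvK : involutive linv.
Proof. by case=> x b; rewrite /linv /= negbK. Qed.

Lemma reduced_behead a s : reduced (a :: s) -> reduced s.
Proof. exact: path_sorted. Qed.

Lemma reduced_lpush a s : reduced s -> reduced (lpush a s).
Proof.
case: s => [|b s] //= rs; case: ifP => [_|/negbT nb]; first exact: path_sorted rs.
by rewrite /= nb.
Qed.

Lemma reduced_wmul s t : reduced t -> reduced (wmul s t).
Proof. by move=> rt; elim: s => //= a s; apply: reduced_lpush. Qed.

Lemma lpushE a s : reduced (a :: s) -> lpush a s = a :: s.
Proof. by case: s => [|b s] //= /andP[/negPf->]. Qed.

Lemma lpushK a s : reduced s -> lpush a (lpush (linv a) s) = s.
Proof.
case: s => [|b s] rs; first by rewrite /= eqxx.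
rewrite /= linvK; have [eab|nab] := eqVneq b a; last by rewrite /= eqxx.
by subst b; apply: lpushE.
Qed.

Lemma lpushVK a s : reduced s -> lpush (linv a) (lpush a s) = s.
Proof. by move=> rs; rewrite -{2}[a]linvK lpushK. Qed.

Lemma wmul_lpush a w u : reduced u -> wmul (lpush a w) u = lpush a (wmul w u).
Proof.
case: w => [|b w] //= ru; case: ifP => [/eqP->|_ //].
by rewrite lpushK //; apply: reduced_wmul.
Qed.

Lemma wmulA s t u : reduced u -> wmul s (wmul t u) = wmul (wmul s t) u.
Proof. by move=> ru; elim: s => //= a s ->; rewrite wmul_lpush. Qed.

Lemma wmuls0 s : reduced s -> wmul s [::] = s.
Proof.
elim: s => //= a s IHs rs; rewrite IHs ?(reduced_behead rs) //; exact: lpushE.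
Qed.

Lemma wmulVw s : reduced s -> wmul (winv s) s = [::].
Proof.
elim: s => //= a s IHs rs.
rewrite /winv /= rev_cons /wmul foldr_rcons /= linvK eqxx.
exact: IHs (reduced_behead rs).
Qed.

Lemma winvK : involutive winv.
Proof.
move=> s; rewrite /winv map_rev revK -map_comp -[RHS]map_id.
by apply: eq_map => a /=; rewrite linvK.
Qed.

Lemma reduced_winv s : reduced s -> reduced (winv s).
Proof.
rewrite /winv /reduced rev_sorted sorted_map; apply: sub_sorted => a b /=.
by rewrite linvK; apply: contraNneq => ->.
Qed.

Definition free_group := {s : seq letter | reduced s}.
HB.instance Definition _ := Choice.on free_group.

Implicit Types p q r : free_group.

Definition fg_one : free_group := exist _ [::] isT.
Definition fg_mul p q : free_group :=
  exist _ (wmul (val p) (val q)) (reduced_wmul (val p) (valP q)).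
Definition fg_inv p : free_group :=
  exist _ (winv (val p)) (reduced_winv (valP p)).

Lemma fg_mulA : associative fg_mul.
Proof. by move=> p q r; apply: val_inj; rewrite /= wmulA ?(valP r). Qed.
Lemma fg_1mul : left_id fg_one fg_mul.
Proof. by move=> p; apply: val_inj. Qed.
Lemma fg_mul1 : right_id fg_one fg_mul.
Proof. by move=> p; apply: val_inj; rewrite /= wmuls0 ?(valP p). Qed.
Lemma fg_mulVp : left_inverse fg_one fg_inv fg_mul.
Proof. by move=> p; apply: val_inj; rewrite /= wmulVw ?(valP p). Qed.
Lemma fg_mulpV : right_inverse fg_one fg_inv fg_mul.
Proof.
move=> p; apply: val_inj => /=; rewrite -{1}[val p]winvK.
exact/wmulVw/reduced_winv/(valP p).
Qed.

HB.instance Definition _ :=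
  isGroup.Build free_group fg_mulA fg_1mul fg_mul1 fg_mulVp fg_mulpV.

Definition fg_gen (x : X) : free_group := exist _ [:: (x, false)] isT.

Section Lift.
Variables (H : groupType) (h : X -> H).

Definition fg_eval_letter a : H := if a.2 then (h a.1)^-1%g else h a.1.

Definition fg_lift p : H := foldr (fun a y => fg_eval_letter a * y)%g 1%g (val p).

Lemma fg_eval_linv a : fg_eval_letter (linv a) = (fg_eval_letter a)^-1%g.
Proof. by case: a => x [] //=; rewrite /fg_eval_letter /= invgK. Qed.

Lemma fg_lift_mul : {morph fg_lift : p q / (p * q)%g >-> (p * q)%g}.
Proof.
move=> [s rs] [t rt]; rewrite /fg_lift /=; elim: s {rs} => [|a s IHs] /=.
  by rewrite mul1g.
rewrite -mulgA -IHs; case: (wmul s t) => [|b w] //=.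
by case: ifP => [/eqP->|] //=; rewrite fg_eval_linv mulVKg.
Qed.

HB.instance Definition _ :=
  monoid.isMultiplicative.Build free_group H fg_lift fg_lift_mul.

Lemma fg_lift_gen x : fg_lift (fg_gen x) = h x.
Proof. by rewrite /fg_lift /= mulg1. Qed.

Lemma fg_lift_unique (mu : {multiplicative free_group -> H}) :
  (forall x, mu (fg_gen x) = h x) -> mu =1 fg_lift.
Proof.
move=> mux; have mu1 : mu 1%g = 1%g.
  by apply: (@mulgI _ (mu 1%g)); rewrite -gmulfM !mulg1.
have muV p : mu p^-1%g = (mu p)^-1%g.
  by apply: (@mulgI _ (mu p)); rewrite -gmulfM !mulgV.
have mua a : mu (exist _ [:: a] isT) = fg_eval_letter a.
  case: a => x [] /=; rewrite /fg_eval_letter /= -mux // -muV.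
  by congr (mu _); apply: val_inj.
case=> s; elim: s => [|a s IHs] rs.
  by rewrite -[RHS]mu1; congr (mu _); apply: val_inj.
have rs' := reduced_behead rs.
pose p : free_group := exist _ [:: a] isT; pose q : free_group := exist _ s rs'.
have -> : exist _ (a :: s) rs = (p * q)%g :> free_group.
  by apply: val_inj; rewrite /= lpushE.
by rewrite fg_lift_mul gmulfM mua IHs {2}/fg_lift /= mulg1.
Qed.

End Lift.
End FreeGroup.

Section GroupAlgebra.
Variables (F : fieldType) (H : groupType).

(* The library has the additive structure of {malg F[H]} for every H, but its
   product only for monoids without nontrivial units.                         *)
Definition group_algebra := {malg F[H]}.
HB.instance Definition _ := GRing.Lmodule.copy group_algebra {malg F[H]}.

Implicit Types f g : group_algebra.

Definition ga_one : group_algebra := mkmalgU (1%g : H) 1.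
Definition ga_mul f g : group_algebra :=
  \sum_(x <- msupp f) \sum_(y <- msupp g)
    mkmalgU (x * y)%g (mcoeff x f * mcoeff y g).

Lemma ga_mulw (d1 d2 : {fset H}) f g :
  (msupp f `<=` d1)%fset -> (msupp g `<=` d2)%fset ->
  ga_mul f g = \sum_(x <- d1) \sum_(y <- d2)
    mkmalgU (x * y)%g (mcoeff x f * mcoeff y g).
Proof.
move=> le1 le2; rewrite /ga_mul (big_fset_incl _ le1) /=.
  apply: eq_bigr => x _; apply: big_fset_incl => // y _ /mcoeff_outdom ->.
  by rewrite mulr0 monalgU0.
move=> x _ /mcoeff_outdom fx.
by rewrite big1 // => y _; rewrite fx mul0r monalgU0.
Qed.

Lemma ga_mulUU (c d : F) (x y : H) :
  ga_mul (mkmalgU x c) (mkmalgU y d) = mkmalgU (x * y)%g (c * d).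
Proof. by rewrite (ga_mulw msuppU_le msuppU_le) !big_seq_fset1 !mcoeffUU. Qed.

Lemma ga_mulDl : left_distributive ga_mul +%R.
Proof.
move=> f g h.
rewrite [in RHS](ga_mulw (fsubsetUl _ (msupp g)) (fsubset_refl _)).
rewrite [in RHS](ga_mulw (fsubsetUr (msupp f) _) (fsubset_refl _)).
rewrite (ga_mulw (msuppD_le _ _) (fsubset_refl _)) -big_split /=.
apply: eq_bigr => x _; rewrite -big_split /=; apply: eq_bigr => y _.
by rewrite mcoeffD mulrDl monalgUD.
Qed.

Lemma ga_mulDr : right_distributive ga_mul +%R.
Proof.
move=> h f g.
rewrite [in RHS](ga_mulw (fsubset_refl _) (fsubsetUl _ (msupp g))).
rewrite [in RHS](ga_mulw (fsubset_refl _) (fsubsetUr (msupp f) _)).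
rewrite (ga_mulw (fsubset_refl _) (msuppD_le _ _)) -big_split /=.
apply: eq_bigr => x _; rewrite -big_split /=; apply: eq_bigr => y _.
by rewrite mcoeffD mulrDr monalgUD.
Qed.

Lemma ga_0mul : left_zero 0 ga_mul.
Proof. by move=> f; rewrite /ga_mul msupp0 big_seq_fset0. Qed.

Lemma ga_mul0 : right_zero 0 ga_mul.
Proof.
by move=> f; rewrite /ga_mul msupp0 big1 // => x _; rewrite big_seq_fset0.
Qed.

Lemma ga_suml (I : Type) (r : seq I) (E : I -> group_algebra) g :
  ga_mul (\sum_(i <- r) E i) g = \sum_(i <- r) ga_mul (E i) g.
Proof.
exact: (big_morph (ga_mul^~ g) (fun _ _ => ga_mulDl _ _ _) (ga_0mul g)).
Qed.

Lemma ga_sumr (I : Type) (r : seq I) (E : I -> group_algebra) f :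
  ga_mul f (\sum_(i <- r) E i) = \sum_(i <- r) ga_mul f (E i).
Proof.
exact: (big_morph (ga_mul f) (fun _ _ => ga_mulDr _ _ _) (ga_mul0 f)).
Qed.

Lemma ga_mulA : associative ga_mul.
Proof.
move=> f g h; rewrite [f]monalgE !(ga_suml (msupp f)).
apply: eq_bigr => x _.
rewrite [g]monalgE (ga_sumr (msupp g)) !(ga_suml (msupp g)) ga_sumr.
apply: eq_bigr => y _.
rewrite [h]monalgE !(ga_sumr (msupp h)); apply: eq_bigr => z _.
by rewrite !ga_mulUU mulrA mulgA.
Qed.

Lemma ga_1mul : left_id ga_one ga_mul.
Proof.
move=> f; rewrite [f]monalgE ga_sumr; apply: eq_bigr => x _.
by rewrite ga_mulUU mul1r mul1g.
Qed.

Lemma ga_mul1 : right_id ga_one ga_mul.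
Proof.
move=> f; rewrite [f]monalgE ga_suml; apply: eq_bigr => x _.
by rewrite ga_mulUU mulr1 mulg1.
Qed.

Lemma ga_one_neq0 : ga_one != 0.
Proof. by rewrite monalgU_eq0 oner_eq0. Qed.

HB.instance Definition _ := GRing.Zmodule_isNzRing.Build group_algebra
  ga_mulA ga_1mul ga_mul1 ga_mulDl ga_mulDr ga_one_neq0.

Lemma ga_mulE f g : f * g = ga_mul f g. Proof. by []. Qed.

Lemma ga_scaleU (c d : F) (x : H) :
  c *: (mkmalgU x d : group_algebra) = mkmalgU x (c * d).
Proof. by apply/malgP => y; rewrite mcoeffZ !mcoeffU mulrnAr. Qed.

Lemma ga_scaleAl (c : F) f g : c *: (f * g) = (c *: f) * g.
Proof.
rewrite !ga_mulE [f]monalgE (ga_suml (msupp f)) !scaler_sumr ga_suml.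
apply: eq_bigr => x _.
rewrite [g]monalgE (ga_sumr (msupp g)) scaler_sumr (ga_sumr (msupp g)).
apply: eq_bigr => y _.
by rewrite ga_scaleU !ga_mulUU ga_scaleU mulrA.
Qed.

Lemma ga_scaleAr (c : F) f g : c *: (f * g) = f * (c *: g).
Proof.
rewrite !ga_mulE [f]monalgE (ga_suml (msupp f)) scaler_sumr (ga_suml (msupp f)).
apply: eq_bigr => x _.
rewrite [g]monalgE (ga_sumr (msupp g)) !scaler_sumr ga_sumr.
apply: eq_bigr => y _.
by rewrite ga_scaleU !ga_mulUU ga_scaleU mulrCA.
Qed.

HB.instance Definition _ :=
  GRing.Lmodule_isLalgebra.Build F group_algebra ga_scaleAl.
HB.instance Definition _ :=
  GRing.Lalgebra_isAlgebra.Build F group_algebra ga_scaleAr.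

Definition ga_inj (x : H) : group_algebra := mkmalgU x 1.

End GroupAlgebra.

(* The F-linear extension of mu; below, an F-algebra morphism when mu is a group
   morphism. *)
Definition ga_map (F : fieldType) (G H : groupType) (mu : G -> H)
    (f : group_algebra F G) : group_algebra F H :=
  \sum_(x <- msupp f) mcoeff x f *: ga_inj F (mu x).

Section GroupAlgebraMap.
Variables (F : fieldType) (G H : groupType) (mu : {multiplicative G -> H}).
Implicit Types f g : group_algebra F G.
Local Notation phi := (@ga_map F G H mu).

Lemma ga_mapw (d : {fset G}) f : (msupp f `<=` d)%fset ->
  phi f = \sum_(x <- d) mcoeff x f *: ga_inj F (mu x).
Proof.
move=> le; rewrite /ga_map (big_fset_incl _ le) // => x _ /mcoeff_outdom ->.
by rewrite scale0r.
Qed.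

Lemma ga_mapU (c : F) (x : G) : phi (mkmalgU x c) = c *: ga_inj F (mu x).
Proof. by rewrite (ga_mapw msuppU_le) big_seq_fset1 mcoeffUU. Qed.

Lemma ga_mapD : {morph phi : f g / f + g}.
Proof.
move=> f g; rewrite (ga_mapw (msuppD_le f g)).
rewrite (ga_mapw (fsubsetUl _ (msupp g))) (ga_mapw (fsubsetUr (msupp f) _)).
by rewrite -big_split /=; apply: eq_bigr => x _; rewrite mcoeffD scalerDl.
Qed.

Lemma ga_map_is_linear : linear phi.
Proof.
move=> c f g; rewrite ga_mapD (ga_mapw (msuppZ_le c f)) scaler_sumr.
by congr (_ + _); apply: eq_bigr => x _; rewrite mcoeffZ scalerA.
Qed.

HB.instance Definition _ := GRing.isLinear.Build F (group_algebra F G)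
  (group_algebra F H) *:%R phi ga_map_is_linear.

Lemma ga_map_is_monoid_morphism : monoid_morphism phi.
Proof.
split.
  rewrite ga_mapU scale1r; congr mkmalgU.
  by apply: (@mulgI _ (mu 1%g)); rewrite -gmulfM !mulg1.
move=> f g; rewrite [f]monalgE [g]monalgE mulr_suml !raddf_sum mulr_suml.
apply: eq_bigr => x _ /=; rewrite !mulr_sumr raddf_sum; apply: eq_bigr => y _ /=.
rewrite ga_mulE ga_mulUU !ga_mapU -scalerAl -scalerAr scalerA ga_mulE.
by rewrite /ga_inj ga_mulUU mulr1 gmulfM.
Qed.

HB.instance Definition _ := GRing.isMonoidMorphism.Build (group_algebra F G)
  (group_algebra F H) phi ga_map_is_monoid_morphism.

End GroupAlgebraMap.

Section SubQuotient.
Variables (R : nzRingType) (M : lmodType R) (N : {pred M}).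
Hypothesis closedN : submod_closed N.

Definition submod_pred (_ : submod_closed N) : {pred M} := N.
Local Notation S := (submod_pred closedN).
HB.instance Definition _ := GRing.isSubmodClosed.Build R M S
  (GRing.submod_closed_semi closedN).

Definition submodule := {x : M | x \in S}.
HB.instance Definition _ := SubType.on submodule.
HB.instance Definition _ := [Choice of submodule by <:].
HB.instance Definition _ := [SubChoice_isSubLmodule of submodule by <:].

Definition quotient_module := Quotient.quot S.
Local Notation Q := quotient_module.
HB.instance Definition _ := GRing.Zmodule.on Q.
HB.instance Definition _ := EqQuotient.on Q.

Local Open Scope quotient_scope.

Definition qm_scale (a : R) : Q -> Q := lift_op1 Q ( *:%R a).

Lemma pi_qm_scale a : {morph \pi_Q : x / a *: x >-> qm_scale a x}.
Proof.
move=> x; unlock qm_scale; apply/eqP; rewrite piE Quotient.equivE.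
by rewrite -scalerBr rpredZ // Quotient.idealrBE reprK.
Qed.

Lemma qm_scaleA a b v : qm_scale a (qm_scale b v) = qm_scale (a * b) v.
Proof. by rewrite -[v]reprK -!pi_qm_scale scalerA. Qed.
Lemma qm_scale1 : left_id 1 qm_scale.
Proof. by move=> v; rewrite -[v]reprK -!pi_qm_scale scale1r. Qed.
Lemma qm_scaleDr : right_distributive qm_scale +%R.
Proof.
by move=> a u v; rewrite -[u]reprK -[v]reprK -raddfD -!pi_qm_scale -raddfD scalerDr.
Qed.
Lemma qm_scaleDl v : {morph qm_scale^~ v : a b / a + b}.
Proof. by move=> a b; rewrite -[v]reprK -!pi_qm_scale -raddfD scalerDl. Qed.

HB.instance Definition _ := GRing.Zmodule_isLmodule.Build R Q
  qm_scaleA qm_scale1 qm_scaleDr qm_scaleDl.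

End SubQuotient.

(* Right FH-modules are left modules over the converse ring of FH. *)
Record group_rep (F : fieldType) := GroupRep {
  rep_group : groupType;
  rep_module : lmodType (group_algebra F rep_group)^c
}.

Section Varieties.
Variable F : fieldType.

Definition ract (H : groupType) (M : lmodType (group_algebra F H)^c)
  (a : M) (f : group_algebra F H) : M := (f : (group_algebra F H)^c) *: a.

Lemma ractM (H : groupType) (M : lmodType (group_algebra F H)^c) (a : M)
  (f g : group_algebra F H) : ract (ract a f) g = ract a (f * g).
Proof. exact: scalerA. Qed.

Definition freeG : groupType := free_group nat.

Definition satisfies_identity (E : group_rep F) (f : group_algebra F freeG) :=
  forall (a : rep_module E) (mu : {multiplicative freeG -> rep_group E}),
    ract a (ga_map mu f) = 0.

Definition rep_class := group_rep F -> Prop.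

Definition is_variety (V : rep_class) : Prop :=
  exists I : group_algebra F freeG -> Prop,
    forall E, V E <-> (forall f, I f -> satisfies_identity E f).

Definition class_sub (U V : rep_class) : Prop := forall E, U E -> V E.
Definition class_eq (U V : rep_class) : Prop := forall E, U E <-> V E.

Definition class_mul (U V : rep_class) : rep_class := fun E =>
  exists (N : {pred rep_module E}) (closedN : submod_closed N),
    U (GroupRep (submodule closedN)) /\ V (GroupRep (quotient_module closedN)).

Definition zero_class : rep_class := fun E => forall a : rep_module E, a = 0.

(* [class_prodl [:: U1; ...; Un]] is U1 (U2 (... Un)); the empty product is
   the class of zero modules, which is neutral for [class_mul].              *)
Fixpoint class_prodl (s : seq rep_class) : rep_class :=
  match s with
  | [::] => zero_class
  | [:: U] => U
  | U :: s' => class_mul U (class_prodl s')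
  end.

Definition class_prod (n : nat) (U : 'I_n -> rep_class) : rep_class :=
  class_prodl [seq U i | i <- enum 'I_n].

End Varieties.

(* Main.v *)
(* Taking identities turns the theorem into one about verbal ideals (two-sided
   ideals invariant under the endomorphisms of G) of R = FG: a product UV of
   varieties has the ideal I_V I_U, so that inclusion of products of varieties
   is inclusion J_1...J_l <= I_1...I_k of products of verbal ideals.
   If J J' <= I I', then J <= I or J' <= I': an upper triangular representation
   of G on R x R kills I I' but not a product f g in disjoint variables with f
   outside I and g outside I'.
   If J J' <= I I' and J <= I, then J <= I C and C J' <= I' for the verbal ideal
   C = {c : c J' <= I'}, because right ideals of R are projective: the
   coordinates of an element of J on a dual basis of I lie in C.  The case
   J' <= I' follows through the antipode of R.  Peeling off one factor at a
   time, an induction on k + l refines the inclusion to an equality.           *)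
From Stdlib Require List.
From HB Require Import structures.
Require Import Defs.
From mathcomp Require Import all_boot all_algebra.
From mathcomp Require Import finmap boolp classical_sets.
From mathcomp.multinomials Require Import monalg.
Set Implicit Arguments.
Unset Strict Implicit.
Unset Printing Implicit Defensive.

Import GRing.Theory.

Local Open Scope ring_scope.
Local Open Scope classical_set_scope.

(** * Induction on the free group, and its morphisms *)

Definition gen (x : nat) : freeG := fg_gen x.

(** A reduced word stays reduced when its first letter is removed, and putting the letter back
    causes no cancellation. *)
Lemma freeG_ind (P : freeG -> Prop) : P 1%g ->
  (forall x g, P g -> P (gen x * g)%g) ->
  (forall x g, P g -> P ((gen x)^-1 * g)%g) -> forall g, P g.
Proof.
move=> P1 PM PV [s]; elim: s => [|[x b] s IHs] rs.
  by have -> : exist _ [::] rs = 1%g :> freeG by apply: val_inj.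
have rs' := reduced_behead rs; case: b rs => rs.
  have -> : exist _ ((x, true) :: s) rs = ((gen x)^-1 * exist _ s rs')%g
    :> freeG by apply: val_inj; rewrite /= lpushE.
  exact/PV/IHs.
have -> : exist _ ((x, false) :: s) rs = (gen x * exist _ s rs')%g
  :> freeG by apply: val_inj; rewrite /= lpushE.
exact/PM/IHs.
Qed.

Lemma morph1 (G H : groupType) (mu : {multiplicative G -> H}) : mu 1%g = 1%g.
Proof. by apply: (@mulgI _ (mu 1%g)); rewrite -gmulfM !mulg1. Qed.

Lemma morphV (G H : groupType) (mu : {multiplicative G -> H}) x :
  mu x^-1%g = (mu x)^-1%g.
Proof. by apply: (@mulgI _ (mu x)); rewrite -gmulfM !mulgV morph1. Qed.

Section Lift.
Variables (H : groupType) (h : nat -> H).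
Implicit Types x y : freeG.

Lemma lift_gen n : fg_lift h (gen n) = h n.
Proof. exact: fg_lift_gen. Qed.

Lemma lift1 : fg_lift h (1%g : freeG) = 1%g.
Proof. exact: (morph1 (fg_lift h)). Qed.

Lemma liftM x y : fg_lift h (x * y)%g = (fg_lift h x * fg_lift h y)%g.
Proof. exact: fg_lift_mul. Qed.

Lemma liftV x : fg_lift h x^-1%g = (fg_lift h x)^-1%g.
Proof. exact: (morphV (fg_lift h)). Qed.

End Lift.

Lemma lift_id x : fg_lift gen x = x.
Proof.
elim/freeG_ind: x => [|n x IHx|n x IHx]; first exact: lift1.
- by rewrite liftM lift_gen IHx.
- by rewrite liftM liftV lift_gen IHx.
Qed.

(* A stands for the group algebra FG and e for the inclusion of its basis G. *)
Section GroupBasis.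
Variables (F : fieldType) (A : algType F) (e : freeG -> A).
Hypothesis e1 : e 1%g = 1.
Hypothesis eM : forall x y, e (x * y)%g = e x * e y.
Hypothesis e_ind : forall P : A -> Prop,
  P 0 -> (forall c x r, P r -> P (c *: e x + r)) -> forall r, P r.
Variable ext : forall M : lmodType F, (freeG -> M) -> {linear A -> M}.
Hypothesis ext_e : forall (M : lmodType F) h x, @ext M h (e x) = h x.

(** * Group endomorphisms extended to the group algebra *)

Lemma eVK x : e x^-1%g * e x = 1. Proof. by rewrite -eM mulVg. Qed.
Lemma eKV x : e x * e x^-1%g = 1. Proof. by rewrite -eM mulgV. Qed.

Definition emap (mu : freeG -> freeG) : {linear A -> A} := ext (e \o mu).

Lemma emap_e mu x : emap mu (e x) = e (mu x). Proof. exact: ext_e. Qed.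

Lemma emapM (mu : {multiplicative freeG -> freeG}) r s :
  emap mu (r * s) = emap mu r * emap mu s.
Proof.
elim/e_ind: r => [|c x r IHr]; first by rewrite mul0r linear0 mul0r.
rewrite mulrDl -scalerAl !linearP /= mulrDl IHr -scalerAl; congr (_ *: _ + _).
elim/e_ind: s {IHr} => [|d y s IHs]; first by rewrite mulr0 linear0 mulr0.
rewrite mulrDr -scalerAr !linearP /= mulrDr IHs -scalerAr.
by rewrite -eM !emap_e gmulfM eM.
Qed.

(** * Right actions of the group algebra prescribed on letters *)

Section Action.
Variables (M : lmodType F) (op : letter nat -> M -> M).
Hypothesis op_linear : forall a, linear (op a).
Hypothesis opK : forall a m, op (linv a) (op a m) = m.
Implicit Types (s t : seq (letter nat)) (r : A) (m n : M).

Definition wact m s : M := foldl (fun m a => op a m) m s.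

Lemma wact_linear s : linear (wact^~ s).
Proof. by elim: s => [|a s IHs] c m n //=; rewrite op_linear IHs. Qed.

(** Cancelling a letter against its inverse does not change the action, by [opK]; so the action of
    words respects products in the group. *)
Lemma wact_lpush a s m : wact m (lpush a s) = wact (op a m) s.
Proof. by case: s => [|b s] //=; case: ifP => [/eqP->|] //=; rewrite opK. Qed.

Lemma wact_wmul s t m : wact m (wmul s t) = wact (wact m s) t.
Proof. by elim: s m => //= a s IHs m; rewrite wact_lpush IHs. Qed.

Definition act m : {linear A -> M} := ext (fun w : freeG => wact m (sval w)).

Lemma act_e m (w : freeG) : act m (e w) = wact m (sval w).
Proof. exact: ext_e. Qed.

Lemma act_linearl r : linear (act^~ r).
Proof.
move=> c m n; elim/e_ind: r => [|d x r IHr].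
  by rewrite /= !linear0 addr0.
rewrite /= !linearP /= IHr !act_e wact_linear !scalerDr !scalerA [d * c]mulrC.
by rewrite addrACA.
Qed.

Lemma actM m r r' : act m (r * r') = act (act m r) r'.
Proof.
elim/e_ind: r => [|c x r IHr].
  have := act_linearl r' (-1) 0 0.
  by rewrite scaler0 addr0 scaleN1r addNr mul0r !linear0 => ->.
rewrite mulrDl -scalerAl !linearP act_linearl /= IHr; congr (_ *: _ + _).
elim/e_ind: r' {IHr} => [|d y r' IHr']; first by rewrite mulr0 !linear0.
rewrite mulrDr -scalerAr !linearP /= IHr' -eM !act_e; congr (_ *: _ + _).
exact: (wact_wmul (sval x) (sval y) m).
Qed.

Lemma act1 m : act m 1 = m.
Proof. by rewrite -e1 act_e. Qed.

Lemma act_gen m x : act m (e (gen x)) = op (x, false) m.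
Proof. by rewrite act_e. Qed.

Lemma act_genV m x : act m (e (gen x)^-1%g) = op (x, true) m.
Proof. by rewrite act_e. Qed.

End Action.

(** * Upper triangular representations of the free group *)

Section TriangularAction.
Variables (t1 t2 : nat -> freeG) (dl : nat -> A -> A).
Hypothesis dl_linear : forall x, linear (dl x).

(* The generator x acts on row vectors by the matrix [[t1 x, dl x], [0, t2 x]]. *)
Definition trop (a : letter nat) (m : A * A) : A * A :=
  if a.2 then
    (m.1 * e (t1 a.1)^-1%g,
     (m.2 - dl a.1 (m.1 * e (t1 a.1)^-1%g)) * e (t2 a.1)^-1%g)
  else (m.1 * e (t1 a.1), m.2 * e (t2 a.1) + dl a.1 m.1).

Lemma trop_linear a : linear (trop a).
Proof.
case: a => x [] c [v w] [v' w']; rewrite /trop /=; congr (_, _).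
- by rewrite mulrDl -scalerAl.
- rewrite (_ : (c *: v + v') * _ = c *: (v * e (t1 x)^-1%g) + v' * e (t1 x)^-1%g).
    rewrite dl_linear /= scalerAl -mulrDl scalerBr; congr (_ * _).
    by rewrite opprD addrACA.
  by rewrite mulrDl -scalerAl.
- by rewrite mulrDl -scalerAl.
- by rewrite mulrDl -scalerAl dl_linear /= scalerDr addrACA.
Qed.

Lemma tropK a m : trop (linv a) (trop a m) = m.
Proof.
case: a m => x [] [v w]; rewrite /trop /=; congr (_, _).
- by rewrite -mulrA eVK mulr1.
- by rewrite -mulrA eVK mulr1 subrK.
- by rewrite -mulrA eKV mulr1.
- by rewrite -!mulrA eKV mulr1 addrK -mulrA eKV mulr1.
Qed.

Definition tract := act trop.

Lemma tractM m r s : tract m (r * s) = tract (tract m r) s.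
Proof. exact: (actM trop_linear tropK). Qed.

Lemma tract1 m : tract m 1 = m. Proof. exact: act1. Qed.
Lemma tract_gen m x : tract m (e (gen x)) = trop (x, false) m.
Proof. exact: act_gen. Qed.
Lemma tract_genV m x : tract m (e (gen x)^-1%g) = trop (x, true) m.
Proof. exact: act_genV. Qed.

Lemma tract_fst m r : (tract m r).1 = m.1 * emap (fg_lift t1) r.
Proof.
elim/e_ind: r => [|c x r IHr]; first by rewrite !linear0 mulr0.
rewrite !linearP /= IHr mulrDr -scalerAr emap_e; congr (_ *: _ + _).
elim/freeG_ind: x m {IHr} => [|x g IHg|x g IHg] m.
- by rewrite e1 tract1 mulr1.
- by rewrite eM tractM IHg tract_gen liftM lift_gen eM mulrA.
- by rewrite eM tractM IHg tract_genV liftM liftV lift_gen eM mulrA.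
Qed.

(** The first coordinate never leaves [I], where the off-diagonal entries vanish, so the second one
    only meets the diagonal entries [t2]. *)
Lemma tract_snd (I : set A) m r : (forall a s, I a -> I (a * s)) ->
  (forall x a, I a -> dl x a = 0) -> I m.1 ->
  (tract m r).2 = m.2 * emap (fg_lift t2) r.
Proof.
move=> IM dlI Im; elim/e_ind: r => [|c x r IHr]; first by rewrite !linear0 mulr0.
rewrite !linearP /= IHr mulrDr -scalerAr emap_e; congr (_ *: _ + _).
elim/freeG_ind: x m {IHr} Im => [|x g IHg|x g IHg] m Im.
- by rewrite e1 tract1 mulr1.
- rewrite eM tractM IHg; first last.
    by rewrite tract_gen; apply: IM.
  by rewrite tract_gen /trop /= dlI // addr0 -mulrA -eM liftM lift_gen.
- rewrite eM tractM IHg; first last.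
    by rewrite tract_genV; apply: IM.
  rewrite tract_genV /trop /= dlI ?subr0; last exact: IM.
  by rewrite -mulrA -eM liftM liftV lift_gen.
Qed.

End TriangularAction.

Lemma emap_lift_gen r : emap (fg_lift gen) r = r.
Proof.
elim/e_ind: r => [|c x r IHr]; first by rewrite linear0.
by rewrite linearP /= IHr emap_e lift_id.
Qed.

(** * Coordinates, and normal forms modulo a subspace *)

Definition coef (h : freeG) : {linear A -> F^o} :=
  ext (fun x => (x == h)%:R : F^o).

Lemma coef_e h x : coef h (e x) = (x == h)%:R.
Proof. exact: ext_e. Qed.

(** Allowing every larger duplicate-free list [s'] lets several elements be expanded over one common
    list. *)
Lemma e_expand r : exists s : seq freeG, forall s', uniq s' ->
  {subset s <= s'} -> r = \sum_(h <- s') coef h r *: e h.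
Proof.
elim/e_ind: r => [|c x r [s IHr]].
  by exists [::] => s' _ _; rewrite big1 // => h _; rewrite linear0 scale0r.
exists (x :: s) => s' us' ss'.
under eq_bigr => h _ do rewrite linearP /= coef_e scalerDl.
rewrite big_split /= -IHr //; last by move=> h hs; apply: ss'; rewrite in_cons hs orbT.
rewrite (bigD1_seq x) ?ss' ?mem_head //= eqxx big1.
  by rewrite addr0 -[_ *: 1]/(c * 1) mulr1.
by move=> h /negPf hx; rewrite eq_sym hx scaler0 scale0r.
Qed.

Section NormalForm.
Variable I : set A.
Hypothesis I0 : I 0.
Hypothesis ID : forall c r s, I r -> I s -> I (c *: r + s).

Let IZ c r : I r -> I (c *: r).
Proof. by move=> Ir; rewrite -[X in I X]addr0; apply: ID. Qed.
Let IN r : I r -> I (- r).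
Proof. by rewrite -scaleN1r; apply: IZ. Qed.
Let IA r s : I r -> I s -> I (r + s).
Proof. by move=> Ir Is; rewrite -[r]scale1r; apply: ID. Qed.

(* Elements of G are rewritten modulo I into smaller ones for an enumeration of
   G; the irreducible ones form the basis B of a complement of I. *)
Let rank (h : freeG) : nat := choice.pickle (sval h : seq (nat * bool)).
Let rank_inj : injective rank.
Proof.
move=> x y /(pcan_inj choice.pickleK).
exact: (@val_inj _ _ (free_group nat : subType (@reduced nat)) x y).
Qed.

Let supp (S : set freeG) r := forall h, coef h r != 0 -> S h.

Let suppD S c r s : supp S r -> supp S s -> supp S (c *: r + s).
Proof.
move=> Sr Ss h; rewrite linearP /=.
have [r0|/Sr//] := eqVneq (coef h r) 0.
by rewrite r0 scaler0 add0r; apply: Ss.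
Qed.

Let B : set freeG := [set g | ~ exists r,
  I (e g - r) /\ supp [set h | rank h < rank g]%N r].

Let reduce_sum r : supp [set h | exists r', I (e h - r') /\ supp B r'] r ->
  exists r', I (r - r') /\ supp B r'.
Proof.
move=> Sr; have [s /(_ (undup s) (undup_uniq s))] := e_expand r.
move=> /(_ _)/wrap[|->]; first by move=> h; rewrite mem_undup.
elim: (undup s) => [|h t [r' [Ir' Br']]].
  by exists 0; rewrite big_nil subr0; split=> // h; rewrite linear0 eqxx.
rewrite big_cons; have [->|/Sr[r1 [Ir1 Br1]]] := eqVneq (coef h r) 0.
  by exists r'; rewrite scale0r add0r.
exists (coef h r *: r1 + r'); split; last exact: suppD.
by rewrite opprD addrACA -scalerBr; apply: ID.
Qed.

(** Strong induction on [rank]: an element outside [B] is congruent modulo [I] to a combination of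
    smaller ones, which reduce by induction. *)
Let reduce_e g : exists r, I (e g - r) /\ supp B r.
Proof.
have [n] := ubnP (rank g); elim: n g => // n IHn g; rewrite ltnS => gn.
have [Bg|/contrapT[r [Ir Sr]]] := pselect (B g).
  exists (e g); rewrite subrr; split=> // h; rewrite coef_e.
  by have [<-|_] := eqVneq g h => //; rewrite eqxx.
have [|r' [Ir' Br']] := reduce_sum (r := r).
  by move=> h /Sr hg; apply: IHn; apply: leq_trans hg gn.
exists r'; split=> //; rewrite -[e g](subrK r) -addrA; exact: IA.
Qed.

Let supp_bound r : exists n, supp [set h | rank h < n]%N r.
Proof.
elim/e_ind: r => [|c x r [n Sr]].
  by exists 0%N => h; rewrite linear0 eqxx.
exists (maxn (rank x).+1 n); apply: suppD => h.
  rewrite coef_e; have [<- _|_] := eqVneq x h; last by rewrite eqxx.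
  exact: leq_maxl.
by move=> /Sr /= hn; apply: leq_trans hn (leq_maxr _ _).
Qed.

Let supp_neq0 r : r != 0 -> exists h, coef h r != 0.
Proof.
move=> r0; apply: contrapT => nh; move/negP: r0; apply.
have [s /(_ (undup s) (undup_uniq s))] := e_expand r.
move=> /(_ _)/wrap[|->]; first by move=> h; rewrite mem_undup.
rewrite big1 // => h _; have [->|h0] := eqVneq (coef h r) 0; first exact: scale0r.
by case: nh; exists h.
Qed.

(** The group element of largest rank in a nonzero [r] could be solved for modulo [I] in terms of
    smaller ones, against its membership in [B]; so the bound on the ranks descends to 0. *)
Let reduced0 r : I r -> supp B r -> r = 0.
Proof.
move=> Ir Br; have [n] := supp_bound r; elim: n => [|n IHn] Sr.
  by apply/eqP/negPn/negP => /supp_neq0[h /Sr].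
apply: IHn => h h0; have := Sr h h0; rewrite /= ltnS leq_eqVlt.
case/orP=> // /eqP hn; case: (Br _ h0); exists (e h - (coef h r)^-1 *: r).
split=> [|k]; first by rewrite opprB addrC subrK; apply: IZ.
rewrite linearB linearZ /= coef_e hn; have [<-|hk] := eqVneq h k.
  by rewrite -[_ *: _]/(_ * _) mulVf // subrr eqxx.
have [->|k0] := eqVneq (coef k r) 0; first by rewrite scaler0 subrr eqxx.
move=> _; have := Sr k k0; rewrite /= ltnS leq_eqVlt => /orP[/eqP kn|//].
by case/eqP: hk; apply: rank_inj; rewrite hn kn.
Qed.

Lemma normal_form : exists nf : {linear A -> A},
  (forall r, I (r - nf r)) /\ (forall r, I r -> nf r = 0).
Proof.
(* A reduced representative is chosen for each group element, and the choice is extended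
   linearly. *)
have [h hP] := choice reduce_e; exists (ext h).
have Inf r : I (r - ext h r) /\ supp B (ext h r).
  elim/e_ind: r => [|c x r [Ir Br]].
    by rewrite linear0 subr0; split=> // k; rewrite linear0 eqxx.
  rewrite linearP /= ext_e; have [Ix Bx] := hP x.
  by split; [rewrite opprD addrACA -scalerBr; apply: ID|apply: suppD].
split=> [r|r Ir]; first by case: (Inf r).
apply: reduced0; last by case: (Inf r).
rewrite -[ext h r](subKr r); apply: IA => //; apply: IN; by case: (Inf r).
Qed.

(** Normal forms vanish on [I] but not at [f]; a nonzero coordinate of the normal form of [f] is
    rescaled. *)
Lemma separating_functional f : ~ I f -> exists l : {linear A -> F^o},
  (forall r, I r -> l r = 0) /\ l f = 1.
Proof.
have [nf [nfI nf0]] := normal_form => nIf.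
have [|h h0] := @supp_neq0 (nf f).
  by apply: contra_notN nIf => /eqP f0; have := nfI f; rewrite f0 subr0.
exists ((coef h (nf f))^-1 \*: (coef h \o nf)); split=> [r Ir|] /=.
  by rewrite (nf0 r) // !linear0.
exact: mulVf.
Qed.

End NormalForm.

Inductive asum (S : set A) : set A :=
| asum0 : asum S 0
| asumD x r : S x -> asum S r -> asum S (x + r).

(** * Projectivity of right ideals of the group algebra *)

Section DualBasis.
Variables (I : set A) (pj nf : {linear A -> A}).
Hypothesis IM : forall a s, I a -> I (a * s).
Hypothesis IB : forall a s, I a -> I s -> I (a - s).
Hypothesis pjI : forall r, I (pj r).
Hypothesis pj_nf : forall r, r - nf r = pj r.
Hypothesis nf0 : forall r, I r -> nf r = 0.

Let pj_id r : I r -> pj r = r.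
Proof. by move=> Ir; rewrite -pj_nf nf0 // subr0. Qed.

(* [d] measures the failure of the projection [pj] onto I to be right linear.  On
   words, a |-> pj a - pj 1 * a is a cocycle with the values [d x] on generators,
   hence a combination of the cocycles given by the coordinates [dl]. *)
Let d x v := pj (v * e (gen x)) - pj v * e (gen x).

Let d_linear x : linear (d x).
Proof.
move=> c r s; rewrite /d mulrDl -scalerAl !linearP /= mulrDl -scalerAl.
by rewrite opprD addrACA -scalerBr.
Qed.

Let dlin x : {linear A -> A} :=
  HB.pack (d x) (GRing.isLinear.Build F A A *:%R (d x) (d_linear x)).

(** [pj] is the identity on the right ideal [I], so [d x] vanishes there and only the normal form of
    [v] counts. *)
Let d_nf x v : d x v = d x (nf v).
Proof.
have d0 u : I u -> d x u = 0.
  by move=> Iu; rewrite /d !pj_id ?subrr //; apply: IM.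
rewrite -{1}[v](subrK (nf v)) -[LHS]/(dlin x _) linearD /= d0 ?add0r //.
by rewrite pj_nf.
Qed.

(** For [t = (h, y)] this is the coordinate of [nf v] at [h], switched on only for the generator
    [y]; these are the coefficients of [d x v] on the elements [D t] of [I]. *)
Let dl (t : freeG * nat) (x : nat) (v : A) : A :=
  (x == t.2)%:R *: (coef t.1 (nf v) *: 1).

Let dl_linear t x : linear (dl t x).
Proof.
move=> c r s; rewrite /dl !linearP /= scalerDl scalerDr; congr (_ + _).
rewrite -[c *: coef _ _]/(c * coef _ _) !scalerA.
by rewrite mulrCA.
Qed.

Let D (t : freeG * nat) := d t.2 (e t.1).

Let d_expand v x : exists s : seq (freeG * nat), forall s', uniq s' ->
  {subset s <= s'} -> d x v = \sum_(t <- s') D t * dl t x v.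
Proof.
have [s sP] := e_expand (nf v); exists [seq (h, x) | h <- s] => s' us' ss'.
(* Only the pairs of [s'] with second component [x] contribute. *)
rewrite d_nf [in LHS](sP [seq t.1 | t <- s' & t.2 == x]).
- rewrite -[LHS]/(dlin x _) linear_sum big_map big_filter [RHS]big_mkcond /=.
  rewrite big_mkcond /=; apply: eq_bigr => -[h y] _ /=; rewrite /D /dl /= eq_sym.
  have [->|_] := eqVneq x y; last by rewrite scale0r mulr0.
  by rewrite scale1r -[LHS]/(dlin y _) linearZ /= -scalerAr mulr1.
- rewrite map_inj_in_uniq ?filter_uniq // => -[h y] [h' y'].
  by rewrite !mem_filter /= => /andP[/eqP-> _] /andP[/eqP-> _] ->.
- move=> h hs; apply/mapP; exists (h, x) => //; rewrite mem_filter eqxx /=.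
  by apply: ss'; apply: map_f.
Qed.

Let tr t := tract gen gen (dl t).

(** Both sides obey the same rule when a letter is put in front of [g], and they agree on generators
    by [d_expand]. The first letter changes both [v] and [W], hence the quantification over them. *)
Let cocycle g : forall v, exists s : seq (freeG * nat), forall s', uniq s' ->
  {subset s <= s'} -> forall W : freeG * nat -> A,
  \sum_(t <- s') D t * (tr t (v, W t) (e g)).2 =
  (\sum_(t <- s') D t * W t) * e g + (pj (v * e g) - pj v * e g).
Proof.
have sub2 (s1 s2 s' : seq (freeG * nat)) : {subset s1 ++ s2 <= s'} ->
    {subset s1 <= s'} /\ {subset s2 <= s'}.
  by move=> ss'; split=> t ts; apply: ss'; rewrite mem_cat ts ?orbT.
elim/freeG_ind: g => [|x g IHg|x g IHg] v.
- exists [::] => s' us' _ W; rewrite e1 !mulr1 subrr addr0.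
  by apply: eq_bigr => t _; rewrite /tr tract1.
- have [s1 s1P] := IHg (v * e (gen x)); have [s2 s2P] := d_expand v x.
  exists (s1 ++ s2) => s' us' /sub2[/(s1P _ us') s1E /(s2P _ us') s2E] W.
  (* [W'] is the second coordinate once the first letter has acted. *)
  pose W' t := W t * e (gen x) + dl t x v.
  rewrite eM; under eq_bigr => t _.
    by rewrite /tr tractM ?tract_gen /trop /= -/(tr t) -/(W' t); [over|].
  rewrite s1E /W'; under eq_bigr => t _ do rewrite mulrDr mulrA.
  rewrite big_split /= -s2E -mulr_suml mulrDl /d !mulrBl !mulrA.
  by rewrite -!addrA; congr (_ + _); rewrite addrCA subrKC addrC.
- have [s1 s1P] := IHg (v * e (gen x)^-1%g).
  (* For an inverse letter the generator relation is used at [v * e (gen x)^-1], which the generator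
     sends back to [v]. *)
  have [s2 s2P] := d_expand (v * e (gen x)^-1%g) x.
  exists (s1 ++ s2) => s' us' /sub2[/(s1P _ us') s1E /(s2P _ us') s2E] W.
  pose W' t := (W t - dl t x (v * e (gen x)^-1%g)) * e (gen x)^-1%g.
  rewrite eM; under eq_bigr => t _.
    by rewrite /tr tractM ?tract_genV /trop /= -/(tr t) -/(W' t); [over|].
  rewrite s1E /W'; under eq_bigr => t _ do rewrite mulrA mulrBr.
  rewrite -mulr_suml sumrB -s2E /d -[v * _ * e (gen x)]mulrA eVK mulr1.
  rewrite !mulrBl !mulrA -[_ * e (gen x) * _ * _]mulrA.
  rewrite -[pj _ * e (gen x) * _]mulrA [e (gen x) * _]mulrA eKV mul1r.
  by rewrite -!addrA; congr (_ + _); rewrite opprB addrC subrKA.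
Qed.

Let cocycle1 r : exists s : seq (freeG * nat), forall s', uniq s' ->
  {subset s <= s'} ->
  \sum_(t <- s') D t * (tr t (1, 0) r).2 = pj r - pj 1 * r.
Proof.
elim/e_ind: r => [|c g r [s1 s1P]].
  exists [::] => s' _ _; rewrite big1 => [|t _]; last by rewrite linear0 mulr0.
  by rewrite mulr0 linear0 subr0.
have [s2 s2P] := cocycle g 1; exists (s1 ++ s2) => s' us' ss'.
under eq_bigr => t _ do rewrite linearP /= mulrDr -scalerAr.
rewrite big_split -scaler_sumr /= (s2P s' us' _ (fun=> 0)); last first.
  by move=> t ts; apply: ss'; rewrite mem_cat ts orbT.
rewrite s1P //; last by move=> t ts; apply: ss'; rewrite mem_cat ts.
rewrite [X in X * _]big1 => [|t _]; last by rewrite mulr0.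
by rewrite mul0r add0r mul1r linearP /= mulrDr -scalerAr opprD addrACA -scalerBr.
Qed.

(** By [cocycle1], [a = pj a] is [pj 1 * a] plus the sum of the [D t] times the second coordinates
    of [tr t (1, 0) a]: one functional is the identity, the others are these coordinates. *)
Lemma dual_basis_aux a : I a -> asum [set r | exists u (f : A -> A),
  [/\ I u, forall r s, f (r + s) = f r + f s,
     forall s x, I s -> f (s * x) = f s * x & r = u * f a]] a.
Proof.
move=> Ia; have [s /(_ (undup s) (undup_uniq s))] := cocycle1 a.
move=> /(_ _)/wrap[|E]; first by move=> t; rewrite mem_undup.
set S := (X in asum X a); have -> : a = pj 1 * a + \sum_(t <- undup s) D t * (tr t (1, 0) a).2.
  by rewrite E (pj_id Ia) addrC subrK.
apply: asumD; first by exists (pj 1), id; split.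
elim: (undup s) => [|t s' IHs]; first by rewrite big_nil; apply: asum0.
rewrite big_cons; apply: asumD IHs; exists (D t), (fun r => (tr t (1, 0) r).2).
split=> // [|r s1|r x Ir]; first by apply: IB; [|apply: IM].
  by rewrite linearD.
(* For [r] in [I] the row [tr t (1, 0) r] has first coordinate [r], and [dl t] vanishes on [I]; so
   [x] acts on the second coordinate by right multiplication. *)
rewrite /tr tractM // (tract_snd _ _ (dl_linear t) x IM) ?emap_lift_gen //.
  by move=> y u Iu; rewrite /dl nf0 // !linear0 scale0r scaler0.
by rewrite (tract_fst _ _ (dl_linear t)) /= mul1r emap_lift_gen.
Qed.

End DualBasis.

(* The functionals [f] with values [f a] on [I] form a dual basis: every right
   ideal of the group algebra of a free group is projective. *)
Lemma dual_basis (I : set A) a :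
  I 0 -> (forall c r s, I r -> I s -> I (c *: r + s)) ->
  (forall r s, I r -> I (r * s)) -> I a ->
  asum [set r | exists u (f : A -> A),
    [/\ I u, forall r s, f (r + s) = f r + f s,
     forall s x, I s -> f (s * x) = f s * x & r = u * f a]] a.
Proof.
move=> I0 ID IM; have [nf [nfI nf0]] := normal_form I0 ID.
apply: (@dual_basis_aux I (idfun \- nf) nf) => //.
by move=> r s Ir Is; rewrite addrC -scaleN1r; apply: ID.
Qed.

(** * Products of ideals, and verbal ideals *)

Lemma asum_add (S : set A) r s : asum S r -> asum S s -> asum S (r + s).
Proof.
by move=> Sr Ss; elim: Sr => [|x t Sx _ IHt]; rewrite ?add0r -?addrA //; apply: asumD.
Qed.

Lemma asum_min (S T : set A) : T 0 -> (forall r s, T r -> T s -> T (r + s)) ->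
  S `<=` T -> asum S `<=` T.
Proof. by move=> T0 TD ST r; elim=> // x s Sx _; apply/TD/ST. Qed.

Definition iprod (P Q : set A) : set A :=
  asum [set r | exists p q, [/\ P p, Q q & r = p * q]].

Lemma iprod_mul (P Q : set A) p q : P p -> Q q -> iprod P Q (p * q).
Proof.
move=> Pp Qq; rewrite -[p * q]addr0; apply: asumD (asum0 _).
by exists p, q.
Qed.

Lemma iprod_min (P Q T : set A) : T 0 -> (forall r s, T r -> T s -> T (r + s)) ->
  (forall p q, P p -> Q q -> T (p * q)) -> iprod P Q `<=` T.
Proof.
by move=> T0 TD TM; apply: asum_min => // _ [p [q [Pp Qq ->]]]; apply: TM.
Qed.

Lemma iprodS (P P' Q Q' : set A) : P `<=` P' -> Q `<=` Q' ->
  iprod P Q `<=` iprod P' Q'.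
Proof.
move=> PP' QQ'; apply: iprod_min; [exact: asum0|exact: asum_add|].
by move=> p q Pp Qq; apply: iprod_mul; [apply: PP'|apply: QQ'].
Qed.

(** The maps [fg_lift h] are all the endomorphisms of the free group. Stability under scalars comes
    from left multiplication by multiples of 1. *)
Record verbal (I : set A) : Prop := Verbal {
  verbal0 : I 0;
  verbalD : forall r s, I r -> I s -> I (r + s);
  verbalMl : forall r s, I s -> I (r * s);
  verbalMr : forall r s, I r -> I (r * s);
  verbal_map : forall h r, I r -> I (emap (fg_lift h) r) }.

Lemma verbalZD I c r s : verbal I -> I r -> I s -> I (c *: r + s).
Proof.
move=> vI Ir Is; apply: (verbalD vI) Is; rewrite -[r]mul1r scalerAl.
exact: (verbalMl vI).
Qed.

Lemma verbalN I r : verbal I -> I r -> I (- r).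
Proof. by move=> vI Ir; rewrite -mulN1r; apply: (verbalMl vI). Qed.

Lemma verbalT : verbal setT. Proof. by []. Qed.

Lemma verbal_iprod P Q : verbal P -> verbal Q -> verbal (iprod P Q).
Proof.
move=> vP vQ; split; [exact: asum0|exact: asum_add|move=> r s|move=> r s|move=> h r].
- apply: (@iprod_min P Q [set s | iprod P Q (r * s)]) => /=.
  + by rewrite mulr0; apply: asum0.
  + by move=> x y Hx Hy; rewrite mulrDr; apply: asum_add.
  + by move=> p q Pp Qq; rewrite mulrA; apply: iprod_mul => //; apply: (verbalMl vP).
- apply: (@iprod_min P Q [set r | iprod P Q (r * s)]) => /=.
  + by rewrite mul0r; apply: asum0.
  + by move=> x y Hx Hy; rewrite mulrDl; apply: asum_add.
  + by move=> p q Pp Qq; rewrite -mulrA; apply: iprod_mul => //; apply: (verbalMr vQ).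
- apply: (@iprod_min P Q [set r | iprod P Q (emap (fg_lift h) r)]) => /=.
  + by rewrite linear0; apply: asum0.
  + by move=> x y Hx Hy; rewrite linearD; apply: asum_add.
  + move=> p q Pp Qq; rewrite (emapM (fg_lift h)).
    by apply: iprod_mul; apply: verbal_map.
Qed.

Lemma iprod_subr P Q : verbal Q -> iprod P Q `<=` Q.
Proof.
move=> vQ; apply: iprod_min; [exact: verbal0|exact: verbalD|].
by move=> p q _ Qq; apply: (verbalMl vQ).
Qed.

Lemma iprodTl Q : verbal Q -> iprod setT Q = Q.
Proof.
move=> vQ; apply/seteqP; split=> [|q Qq]; first exact: iprod_subr.
by rewrite -[q]mul1r; apply: iprod_mul.
Qed.

Lemma iprodA (P Q T : set A) : iprod P (iprod Q T) = iprod (iprod P Q) T.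
Proof.
apply/seteqP; split; apply: iprod_min; try exact: asum0; try exact: asum_add.
- move=> p s Pp; apply: (@iprod_min Q T [set s | iprod (iprod P Q) T (p * s)]) => /=.
  + by rewrite mulr0; apply: asum0.
  + by move=> x y Hx Hy; rewrite mulrDr; apply: asum_add.
  + by move=> q t Qq Tt; rewrite mulrA; do 2?apply: iprod_mul.
- move=> r t Hr Tt; move: r Hr.
  apply: (@iprod_min P Q [set r | iprod P (iprod Q T) (r * t)]) => /=.
  + by rewrite mul0r; apply: asum0.
  + by move=> x y Hx Hy; rewrite mulrDl; apply: asum_add.
  + by move=> p q Pp Qq; rewrite -mulrA; do 2?apply: iprod_mul.
Qed.

(** * Substitutions of variables, and quotients of verbal ideals *)

Lemma emap_comp mu nu r : emap mu (emap nu r) = emap (mu \o nu) r.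
Proof.
elim/e_ind: r => [|c x r IHr]; first by rewrite !linear0.
by rewrite !linearP /= IHr !emap_e.
Qed.

Lemma lift_comp (t h : nat -> freeG) x :
  fg_lift t (fg_lift h x) = fg_lift (fun n => fg_lift t (h n)) x.
Proof.
elim/freeG_ind: x => [|n x IHx|n x IHx]; first by rewrite !lift1.
- by rewrite (liftM h) (lift_gen h) (liftM t) IHx liftM lift_gen.
- by rewrite (liftM h) (liftV h) (lift_gen h) (liftM t) liftV IHx liftM liftV lift_gen.
Qed.

Lemma emap_lift_comp t h r : emap (fg_lift t) (emap (fg_lift h) r) =
  emap (fg_lift (fun n => fg_lift t (h n))) r.
Proof.
by rewrite emap_comp; congr (emap _ r); apply: funext => x; apply: lift_comp.
Qed.

Lemma emap_lift_id h r : (forall n, h n = gen n) -> emap (fg_lift h) r = r.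
Proof. by move=> /funext->; apply: emap_lift_gen. Qed.

(** Only finitely many generators occur in an element of the group algebra. *)
Lemma emap_support r : exists N, forall h h', (forall n, (n < N)%N -> h n = h' n) ->
  emap (fg_lift h) r = emap (fg_lift h') r.
Proof.
elim/e_ind: r => [|c x r [N1 IHr]]; first by exists 0%N => *; rewrite !linear0.
have [N2 IHx] : exists N, forall h h' : nat -> freeG,
    (forall n, (n < N)%N -> h n = h' n) -> fg_lift h x = fg_lift h' x.
  elim/freeG_ind: x => [|n x [N IHx]|n x [N IHx]].
  - by exists 0%N => h h' _; rewrite !lift1.
  - exists (maxn n.+1 N) => h h' hh'; rewrite !liftM !lift_gen hh' ?leq_maxl //.
    by rewrite (IHx h h') // => m mN; apply/hh'/(leq_trans mN)/leq_maxr.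
  - exists (maxn n.+1 N) => h h' hh'; rewrite !liftM !liftV !lift_gen hh' ?leq_maxl //.
    by rewrite (IHx h h') // => m mN; apply/hh'/(leq_trans mN)/leq_maxr.
exists (maxn N1 N2) => h h' hh'; rewrite !linearP /= !emap_e.
rewrite (IHr h h') => [|n nN]; last by apply/hh'/(leq_trans nN)/leq_maxl.
by rewrite (IHx h h') // => n nN; apply/hh'/(leq_trans nN)/leq_maxr.
Qed.

(* The variables of the two factors can be made disjoint, as there are
   infinitely many of them. *)
Lemma verbal_rquotient P Q : verbal P -> verbal Q ->
  verbal [set c | forall b, P b -> Q (c * b)].
Proof.
move=> vP vQ; split=> /=.
- by move=> b _; rewrite mul0r; apply: verbal0.
- by move=> r s Hr Hs b Pb; rewrite mulrDl; apply: (verbalD vQ); auto.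
- by move=> r s Hs b Pb; rewrite -mulrA; apply: (verbalMl vQ); auto.
- by move=> r s Hr b Pb; rewrite -mulrA; apply/Hr/(verbalMl vP).
move=> h r Hr b Pb; have [N rN] := emap_support r.
(* [t] acts as [h] on the variables of [r] and undoes the shift by [N] that moves [b] to fresh
   variables. *)
pose t n := if (n < N)%N then h n else gen (n - N).
have -> : emap (fg_lift h) r = emap (fg_lift t) r.
  by apply: rN => n; rewrite /t => ->.
have -> : b = emap (fg_lift t) (emap (fg_lift (fun n => gen (N + n))) b).
  rewrite emap_lift_comp emap_lift_id // => n; rewrite lift_gen /t.
  by rewrite ltnNge leq_addr /= addKn.
rewrite -(emapM (fg_lift t)).
by apply: (verbal_map vQ); apply/Hr/(verbal_map vP).
Qed.

(** * Splitting a factor off an inclusion of products *)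

Lemma factor_left J1 J2 I1 I2 :
  verbal J1 -> verbal J2 -> verbal I1 -> verbal I2 ->
  iprod J1 J2 `<=` iprod I1 I2 -> J1 `<=` I1 ->
  exists C, [/\ verbal C, J1 `<=` iprod I1 C & iprod C J2 `<=` I2].
Proof.
move=> vJ1 vJ2 vI1 vI2 JI J1I1; exists [set c | forall b, J2 b -> I2 (c * b)].
split; first exact: verbal_rquotient; last first.
  apply: iprod_min; [exact: verbal0|exact: verbalD|by move=> c b; apply].
move=> a J1a.
have := dual_basis (verbal0 vI1) (fun c r s => @verbalZD I1 c r s vI1)
  (verbalMr vI1) (J1I1 _ J1a).
apply: asum_min; [exact: asum0|exact: asum_add|].
move=> _ [u [f [I1u fD fM ->]]]; apply: iprod_mul => //= b J2b.
(* [f a * b = f (a * b)] is a value of [f] on [I1 I2]; such values are sums of products [f p * q]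
   with [q] in the left ideal [I2]. *)
rewrite -fM; last exact: J1I1.
have : iprod I1 I2 (a * b) by apply/JI/iprod_mul.
apply: (@iprod_min I1 I2 [set r | I2 (f r)]) => /=.
- by rewrite -[0](mul0r 0) fM; [apply: (verbalMl vI2); apply: verbal0|apply: verbal0].
- by move=> r s Hr Hs; rewrite fD; apply: verbalD.
- by move=> p q I1p I2q; rewrite fM //; apply: (verbalMl vI2).
Qed.
(** The antipode: it reverses products and commutes with substitutions, so it exchanges left and
    right in statements on verbal ideals. *)
Definition anti : {linear A -> A} := ext (fun x => e x^-1%g).

Lemma anti_e x : anti (e x) = e x^-1%g. Proof. exact: ext_e. Qed.

Lemma antiM r s : anti (r * s) = anti s * anti r.
Proof.
elim/e_ind: r => [|c x r IHr]; first by rewrite mul0r linear0 mulr0.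
rewrite mulrDl -scalerAl !linearP /= mulrDr IHr -scalerAr; congr (_ *: _ + _).
elim/e_ind: s {IHr} => [|d y s IHs]; first by rewrite mulr0 linear0 mul0r.
rewrite mulrDr -scalerAr !linearP /= mulrDl IHs -scalerAl.
by rewrite -eM !anti_e invgM eM.
Qed.

Lemma antiK : involutive anti.
Proof.
move=> r; elim/e_ind: r => [|c x r IHr]; first by rewrite !linear0.
by rewrite !linearP /= IHr !anti_e invgK.
Qed.

Lemma anti_emap h r : anti (emap (fg_lift h) r) = emap (fg_lift h) (anti r).
Proof.
elim/e_ind: r => [|c x r IHr]; first by rewrite !linear0.
by rewrite !linearP /= IHr emap_e !anti_e emap_e liftV.
Qed.

Definition iopp (P : set A) : set A := [set r | P (anti r)].

Lemma ioppK P : iopp (iopp P) = P.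
Proof. by apply/seteqP; split=> r; rewrite /iopp /= antiK. Qed.

Lemma ioppS P Q : P `<=` Q -> iopp P `<=` iopp Q.
Proof. by move=> PQ r; apply: PQ. Qed.

Lemma verbal_iopp P : verbal P -> verbal (iopp P).
Proof.
move=> vP; split; rewrite /iopp /=.
- by rewrite linear0; apply: verbal0.
- by move=> r s Pr Ps; rewrite linearD; apply: verbalD.
- by move=> r s Ps; rewrite antiM; apply: (verbalMr vP).
- by move=> r s Pr; rewrite antiM; apply: (verbalMl vP).
- by move=> h r Pr; rewrite anti_emap; apply: (verbal_map vP).
Qed.

Lemma iopp_iprod P Q : iopp (iprod P Q) = iprod (iopp Q) (iopp P).
Proof.
have sub P' Q' : iprod (iopp Q') (iopp P') `<=` iopp (iprod P' Q').
  apply: iprod_min; rewrite /iopp /=.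
  - by rewrite linear0; apply: asum0.
  - by move=> r s Hr Hs; rewrite linearD; apply: asum_add.
  - by move=> p q Pp Qq; rewrite antiM; apply: iprod_mul.
apply/seteqP; split; last exact: sub.
by have := ioppS (sub (iopp Q) (iopp P)); rewrite !ioppK.
Qed.

Lemma factor_right J1 J2 I1 I2 :
  verbal J1 -> verbal J2 -> verbal I1 -> verbal I2 ->
  iprod J1 J2 `<=` iprod I1 I2 -> J2 `<=` I2 ->
  exists C, [/\ verbal C, J2 `<=` iprod C I2 & iprod J1 C `<=` I1].
Proof.
move=> vJ1 vJ2 vI1 vI2 JI J2I2.
have [|||||//|C [vC J2C CI1]] := @factor_left (iopp J2) (iopp J1) (iopp I2) (iopp I1);
  try exact: verbal_iopp.
- by rewrite -!iopp_iprod; apply: ioppS.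
- exact: ioppS.
exists (iopp C); split; first exact: verbal_iopp.
- by have := ioppS J2C; rewrite iopp_iprod !ioppK.
- by have := ioppS CI1; rewrite iopp_iprod !ioppK.
Qed.

(** * Primeness of products of verbal ideals *)

Section Prime.
Variables (P Q : set A) (f g : A) (phi : {linear A -> A}).
Hypotheses (vP : verbal P) (vQ : verbal Q).
Hypothesis phi0 : forall r, P r -> phi r = 0.
Hypothesis phif : phi f = 1.

(** The augmentation of the group algebra. *)
Let aug : {linear A -> F^o} := ext (fun=> 1 : F^o).
Let augD c x r : aug (c *: e x + r) = c + aug r.
Proof. by rewrite linearP /= ext_e -[c *: _]/(c * 1) mulr1. Qed.
(** The variable [2n] acts by the diagonal matrix with entries [gen n] and 1; the variable [2n + 1]
    by the one with entries 1 and [gen n], conjugated by the shift of [w] by [phi v] in rows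
    [(v, w)]. *)
Let t1 x := if odd x then 1%g else gen x./2.
Let t2 x := if odd x then gen x./2 else 1%g.
Let dl x v := if odd x then phi v - phi v * e (gen x./2) else 0.
Let dl_linear x : linear (dl x).
Proof.
move=> c r s; rewrite /dl; case: ifP => _; last by rewrite scaler0 addr0.
by rewrite linearP /= mulrDl -scalerAl opprD addrACA -scalerBr.
Qed.
Let tr := tract t1 t2 dl.
Let ev n := gen n.*2.
Let od n := gen n.*2.+1.

Let tr_ev m r : tr m (emap (fg_lift ev) r) = (m.1 * r, aug r *: m.2).
Proof.
elim/e_ind: r => [|c x r IHr].
  by rewrite !linear0 mulr0 scale0r.
rewrite augD !linearP /= IHr emap_e mulrDr -scalerAr scalerDl.
rewrite -[RHS]/(c *: (m.1 * e x, m.2) + (m.1 * r, aug r *: m.2)).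
congr (_ *: _ + _); elim/freeG_ind: x m {IHr} => [|x g' IHg|x g' IHg] m.
- by rewrite lift1 e1 /tr tract1 mulr1; case: m.
- rewrite liftM lift_gen !eM /tr tractM // -/tr IHg tract_gen /trop /= /dl /t1 /t2.
  by rewrite odd_double doubleK addr0 e1 mulr1 mulrA.
- rewrite liftM liftV lift_gen !eM /tr tractM // -/tr IHg tract_genV /trop /= /dl.
  by rewrite /t1 /t2 odd_double doubleK subr0 invg1 e1 mulr1 mulrA.
Qed.

Let tr_od m r : tr m (emap (fg_lift od) r) =
  (aug r *: m.1, m.2 * r - phi m.1 * r + aug r *: phi m.1).
Proof.
elim/e_ind: r => [|c x r IHr].
  by rewrite !linear0 !mulr0 !scale0r subrr addr0.
rewrite augD !linearP /= IHr emap_e !mulrDr -!scalerAr !scalerDl.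
have -> : tr m (e (fg_lift od x)) = (m.1, m.2 * e x - phi m.1 * e x + phi m.1).
  elim/freeG_ind: x m {IHr} => [|x g' IHg|x g' IHg] m.
  - by rewrite lift1 e1 /tr tract1 !mulr1 subrK; case: m.
  - rewrite liftM lift_gen !eM /tr tractM // -/tr IHg tract_gen /trop /= /dl /t1 /t2.
    rewrite /= odd_double uphalf_double /= e1 mulr1 !mulrA mulrDl mulrBl.
    by congr (_, _ + _); rewrite -addrA [_ - _ - _]addrAC subrr add0r.
  - rewrite liftM liftV lift_gen !eM /tr tractM // -/tr IHg tract_genV /trop /= /dl.
    rewrite /t1 /t2 /= odd_double uphalf_double /= invg1 e1 mulr1 opprB !mulrDl !mulNr !mulrA.
    rewrite -[_ * e (gen x) * e _^-1%g]mulrA eKV mulr1.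
    by congr (_, _ + _); rewrite -addrA [_ - _ - _]addrAC subrr add0r.
rewrite -[LHS]/(c *: m.1 + aug r *: m.1,
  c *: (m.2 * e x - phi m.1 * e x + phi m.1) +
  (m.2 * r - phi m.1 * r + aug r *: phi m.1)).
congr (_, _); rewrite scalerDr scalerBr addrACA [_ - _ + (_ - _)]addrACA.
by rewrite -opprD.
Qed.

(** Elements of the product of [P] and [Q] send the row [(1, 0)] to a row with coordinates in [P]
    and [Q], while [f] times [g] in separate variables sends it to
    [(aug g *: f, aug g *: 1 - g)]. *)
Lemma prime_aux : ~ P f ->
  iprod P Q (emap (fg_lift ev) f * emap (fg_lift od) g) -> Q g.
Proof.
move=> nPf.
have tr_iprod r : iprod P Q r -> P (tr (1, 0) r).1 /\ Q (tr (1, 0) r).2.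
  apply: (@iprod_min P Q [set r | P (tr (1, 0) r).1 /\ Q (tr (1, 0) r).2]) => /=.
  - by rewrite !linear0; split; apply: verbal0.
  - move=> x y [Px Qx] [Py Qy]; rewrite !linearD; split; exact: verbalD.
  - move=> p q Pp Qq; rewrite /tr tractM // -/tr.
    (* After [p] the first coordinate lies in [P], where [phi] and so [dl] vanish; [q] then
       multiplies the second one by an element of [Q]. *)
    have Pp1 : P (tr (1, 0) p).1.
      rewrite (tract_fst _ _ dl_linear) /= mul1r; exact: (verbal_map vP).
    split; first by rewrite (tract_fst _ _ dl_linear); apply: (verbalMr vP).
    rewrite (tract_snd _ _ dl_linear _ (verbalMr vP)) //.
      by apply/(verbalMl vQ)/(verbal_map vQ).
    by move=> x a Pa; rewrite /dl phi0 // mul0r subr0 if_same.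
move=> /tr_iprod; rewrite /tr tractM // -/tr tr_ev tr_od /= mul1r phif => -[Pf Qg].
(* If [aug g] vanishes, the second coordinate is [- g]; otherwise the first one would put [f] in
   [P]. *)
have [g0|g0] := eqVneq (aug g) 0.
  move: Qg; rewrite g0 scaler0 mul0r mul1r add0r scale0r addr0 => Qg.
  by rewrite -[g]opprK; apply: verbalN.
case: nPf; rewrite -[f]scale1r -(mulVf g0) -scalerA -[_ *: _]addr0.
by apply: verbalZD => //; apply: verbal0.
Qed.

End Prime.

Lemma verbal_prime J1 J2 P Q : verbal J1 -> verbal J2 -> verbal P -> verbal Q ->
  iprod J1 J2 `<=` iprod P Q -> J1 `<=` P \/ J2 `<=` Q.
Proof.
move=> vJ1 vJ2 vP vQ JPQ.
have [|nJP] := pselect (J1 `<=` P); [by left|right=> g Jg].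
have [f [Jf nPf]] : exists f, J1 f /\ ~ P f.
  apply: contrapT => nf; apply: nJP => f Jf; apply: contrapT => nPf.
  by apply: nf; exists f.
have [l [lP lf]] := separating_functional (verbal0 vP)
  (fun c r s => @verbalZD P c r s vP) nPf.
(* [phi] is the functional separating [f] from [P], with scalars viewed in [A]. *)
pose phi : {linear A -> A} := ext (fun x => l (e x) *: (1 : A)).
have phiE r : phi r = l r *: (1 : A).
  elim/e_ind: r => [|c x r IHr]; first by rewrite !linear0 scale0r.
  by rewrite !linearP /= IHr ext_e scalerDl -scalerA.
apply: (@prime_aux P Q f g phi) => //.
- by move=> r Pr; rewrite phiE lP // scale0r.
- by rewrite phiE lf scale1r.
by apply: JPQ; apply: iprod_mul; apply: verbal_map.
Qed.

(** * Refinement of inclusions between products of ideals *)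

(** The factors are multiplied in reverse order, as ideals of identities do when varieties are
    multiplied. *)
Fixpoint rprod (s : seq (set A)) : set A :=
  if s is P :: s' then iprod (rprod s') P else setT.

Lemma verbal_rprod s : List.Forall verbal s -> verbal (rprod s).
Proof. by elim=> [|P s' vP _ vs]; [exact: verbalT|apply: verbal_iprod]. Qed.

Lemma verbal_full I : verbal I -> setT `<=` I -> I = setT.
Proof. by move=> vI TI; apply/seteqP. Qed.

Theorem verbal_refinement (Is Js : seq (set A)) :
  List.Forall verbal Is -> List.Forall verbal Js -> rprod Js `<=` rprod Is ->
  exists As Bs, [/\ List.Forall verbal As, List.Forall verbal Bs,
    rprod As = rprod Bs, List.Forall2 subset As Is & List.Forall2 subset Js Bs].
Proof.
have [n] := ubnP (size Is + size Js); elim: n Is Js => // n IHn Is Js szIJ vIs vJs.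
case: Is szIJ vIs => [|I Is] szIJ vIs JI.
  (* The empty product is the whole ring, and every entry of [Js] is enlarged to it. *)
  exists [::], [seq setT | _ <- Js]; split=> //=.
  - by elim: Js {JI szIJ vJs} => //= *; constructor.
  - by elim: Js {JI szIJ vJs} => //= J Js <-; rewrite iprodTl.
  - by elim: Js {JI szIJ vJs} => //= *; constructor.
case: Js szIJ vJs JI => [|J Js] szIJ vJs JI.
  (* The product of [I :: Is] contains the empty product, so it is the whole ring. *)
  exists (I :: Is), [::]; split=> //=.
    by apply: verbal_full => //; have := verbal_rprod vIs.
  by elim: (I :: Is) => //= *; constructor.
inversion_clear vIs as [|? ? vI vIs']; inversion_clear vJs as [|? ? vJ vJs'].
have vrI := verbal_rprod vIs'; have vrJ := verbal_rprod vJs'.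
have [JI'|JI'] := verbal_prime vrJ vJ vrI vI JI.
(* [J] is split off. Induction on [C :: Is] and [Js] yields a head [A1] inside [C]; then [A1 J] lies
   in [C J], hence in [I]. *)
- have [C [vC JC CI]] := factor_left vrJ vJ vrI vI JI JI'.
  have [||||[|A1 As] [Bs [vAs vBs AB AIs JBs]]] := IHn (C :: Is) Js.
  + by move: szIJ; rewrite /= addnS ltnS.
  + by constructor.
  + by [].
  + exact: JC.
  + by inversion AIs.
  inversion_clear vAs as [|? ? vA1 vAs']; inversion_clear AIs as [|? ? ? ? A1C AIs'].
  exists (iprod A1 J :: As), (J :: Bs); split; try by constructor.
  + by constructor=> //; apply: verbal_iprod.
  + by rewrite /= -AB /= iprodA.
  + by constructor=> //; apply: subset_trans CI; apply: iprodS.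
(* [I] is split off. Induction on [Is] and [C :: Js] yields a head [B1] containing [C]; then [B1 I]
   contains [C I], hence [J]. *)
- have [C [vC JC CI]] := factor_right vrJ vJ vrI vI JI JI'.
  have [||||As [[|B1 Bs] [vAs vBs AB AIs JBs]]] := IHn Is (C :: Js).
  + by move: szIJ; rewrite /= addSn ltnS.
  + by [].
  + by constructor.
  + exact: CI.
  + by inversion JBs.
  inversion_clear vBs as [|? ? vB1 vBs']; inversion_clear JBs as [|? ? ? ? CB1 JBs'].
  exists (I :: As), (iprod B1 I :: Bs); split; try by constructor.
  + by constructor=> //; apply: verbal_iprod.
  + by rewrite /= AB /= iprodA.
  + by constructor=> //; apply: subset_trans JC _; apply: iprodS.
Qed.

End GroupBasis.

(** * Varieties and verbal ideals *)

Section GroupAlgebraBasis.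
Variables (F : fieldType) (G : groupType).
Local Notation R := (group_algebra F G).
Local Notation inj := (@ga_inj F G).

Lemma ga_ind (P : R -> Prop) :
  P 0 -> (forall c x r, P r -> P (c *: inj x + r)) -> forall r, P r.
Proof.
move=> P0 PD r; rewrite [r]monalgE.
elim: (enum_fset _) => [|x s IHs]; first by rewrite big_nil.
rewrite big_cons; have -> : mkmalgU x (mcoeff x r) = mcoeff x r *: inj x.
  by rewrite ga_scaleU mulr1.
exact: PD.
Qed.

Lemma ga_linear_ext (M : lmodType F) (f g : R -> M) : linear f -> linear g ->
  (forall x, f (inj x) = g (inj x)) -> f =1 g.
Proof.
move=> fL gL fg; apply: ga_ind => [|c x r fgr]; last by rewrite fL gL fg fgr.
have f0 : f 0 = 0 by have := fL (-1) 0 0; rewrite scaler0 addr0 scaleN1r addNr.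
by have := gL (-1) 0 0; rewrite scaler0 addr0 scaleN1r addNr f0.
Qed.

Lemma ga_injM (x y : G) : inj (x * y)%g = inj x * inj y.
Proof. by rewrite ga_mulE ga_mulUU mulr1. Qed.

Variable M : lmodType F.
Implicit Types (h : G -> M) (r s : R).

Definition ga_ext h r : M := \sum_(x <- msupp r) mcoeff x r *: h x.

Lemma ga_extw h (d : {fset G}) r : (msupp r `<=` d)%fset ->
  ga_ext h r = \sum_(x <- d) mcoeff x r *: h x.
Proof.
move=> le; rewrite /ga_ext (big_fset_incl _ le) // => x _ /mcoeff_outdom ->.
by rewrite scale0r.
Qed.

Lemma ga_ext_inj h x : ga_ext h (inj x) = h x.
Proof. by rewrite (ga_extw h msuppU_le) big_seq_fset1 mcoeffUU scale1r. Qed.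

Lemma ga_ext_is_linear h : linear (ga_ext h).
Proof.
move=> c r s; pose d := (msupp r `|` msupp s)%fset.
have dr : (msupp r `<=` d)%fset by apply: fsubsetUl.
have ds : (msupp s `<=` d)%fset by apply: fsubsetUr.
have dcr : (msupp (c *: r + s) `<=` d)%fset.
  apply: fsubset_trans (msuppD_le _ _) _; apply: fsetSU; exact: msuppZ_le.
rewrite (ga_extw h dr) (ga_extw h ds) (ga_extw h dcr) scaler_sumr -big_split.
by apply: eq_bigr => x _; rewrite mcoeffD mcoeffZ scalerDl scalerA.
Qed.

HB.instance Definition _ h :=
  GRing.isLinear.Build F R M *:%R (ga_ext h) (ga_ext_is_linear h).

End GroupAlgebraBasis.

Lemma ga_map_inj (F : fieldType) (G H : groupType) (mu : {multiplicative G -> H})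
  (x : G) : ga_map mu (ga_inj F x) = ga_inj F (mu x).
Proof. by rewrite ga_mapU scale1r. Qed.

Lemma linear_mull (F : fieldType) (U : lmodType F) (B : algType F)
  (f : {linear U -> B}) b : linear (fun r => b * f r).
Proof. by move=> c r s; rewrite linearP /= mulrDr -scalerAr. Qed.

Lemma linear_mulr (F : fieldType) (U : lmodType F) (B : algType F)
  (f : {linear U -> B}) b : linear (fun r => f r * b).
Proof. by move=> c r s; rewrite linearP /= mulrDl -scalerAl. Qed.

Lemma linear_compf (F : fieldType) (U V W : lmodType F)
  (f : {linear V -> W}) (g : {linear U -> V}) : linear (fun r => f (g r)).
Proof. by move=> c r s; rewrite !linearP. Qed.

(** * Morphisms from the free group to arbitrary groups *)

Section FreeMorphisms.
Variables (H : groupType) (mu : {multiplicative freeG -> H}).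
Implicit Type x : freeG.

Lemma morph_lift (h : nat -> freeG) x :
  mu (fg_lift h x) = fg_lift (fun n => mu (h n)) x.
Proof.
elim/freeG_ind: x => [|n x IHx|n x IHx]; first by rewrite !lift1 morph1.
- by rewrite (liftM h) (lift_gen h) gmulfM IHx liftM lift_gen.
- by rewrite (liftM h) (liftV h) (lift_gen h) gmulfM morphV IHx liftM liftV lift_gen.
Qed.

Lemma lift_conj (y : H) x :
  (y * mu x = fg_lift (fun n => y * mu (gen n) * y^-1) x * y)%g.
Proof.
elim/freeG_ind: x => [|n x IHx|n x IHx].
- by rewrite morph1 lift1 mul1g mulg1.
- by rewrite gmulfM liftM lift_gen -!mulgA -IHx !mulgA divgK.
- rewrite gmulfM morphV liftM liftV lift_gen -!mulgA -IHx.
  by rewrite !invgM invgK !mulgA divgK.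
Qed.

End FreeMorphisms.

Section FreeMaps.
Variables (F : fieldType) (H : groupType).
Local Notation R := (group_algebra F freeG).

Lemma ga_map_gen (mu : {multiplicative freeG -> H}) :
  ga_map (fg_lift (fun n => mu (gen n))) =1 ga_map mu :> (R -> group_algebra F H).
Proof.
apply: ga_linear_ext => [||x]; try exact: linearP.
apply: etrans (ga_map_inj F _ x) (etrans _ (esym (ga_map_inj F _ x))).
by congr (ga_inj F _); apply/esym; apply: fg_lift_unique.
Qed.

Lemma ga_map_lift (mu : {multiplicative freeG -> H}) (h : nat -> freeG) (r : R) :
  ga_map mu (ga_map (fg_lift h) r : R) = ga_map (fg_lift (fun n => mu (h n))) r.
Proof.
move: r; apply: ga_linear_ext => [||x]; first exact: linear_compf.
  exact: linearP.
apply: etrans (congr1 (ga_map mu) (ga_map_inj F (fg_lift h) x)) _.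
apply: etrans (ga_map_inj F mu _) _.
apply: etrans _ (esym (ga_map_inj F (fg_lift (fun n => mu (h n))) x)).
congr (ga_inj F _); exact: morph_lift.
Qed.

(** Conjugating [mu] by [y] gives another morphism from the free group; this makes the elements
    killed by all values of an ideal stable under the group. *)
Lemma ga_map_conj (mu : {multiplicative freeG -> H}) (y : H) : exists
  nu : {multiplicative freeG -> H}, forall r : R,
  ga_inj F y * ga_map mu r = ga_map nu r * ga_inj F y.
Proof.
exists (fg_lift (fun n => y * mu (gen n) * y^-1)%g).
apply: ga_linear_ext => [||x]; [exact: linear_mull|exact: linear_mulr|].
apply: etrans (congr1 ( *%R (ga_inj F y)) (ga_map_inj F mu x)) _.
apply: etrans _ (esym (congr1 ( *%R^~ (ga_inj F y)) (ga_map_inj F (fg_lift (fun n => y * mu (gen n) * y^-1)%g) x))).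
apply: etrans (esym (ga_injM F _ _)) (etrans _ (ga_injM F _ _)).
congr (ga_inj F _); exact: lift_conj.
Qed.

(** [tau] follows [mu] on the even generators and [nu] on the odd ones. *)
Lemma ga_map_disjoint (mu nu : {multiplicative freeG -> H}) : exists
  (tau : {multiplicative freeG -> H}) (h h' : nat -> freeG),
  (forall r : R, ga_map tau (ga_map (fg_lift h) r : R) = ga_map mu r) /\
  (forall r : R, ga_map tau (ga_map (fg_lift h') r : R) = ga_map nu r).
Proof.
pose t n := if odd n then nu (gen n./2) else mu (gen n./2).
exists (fg_lift t), (fun n => gen n.*2), (fun n => gen n.*2.+1).
split=> r; apply: etrans (ga_map_lift _ _ _) (etrans _ (ga_map_gen _ r));
  congr (ga_map (fg_lift _) r); apply: funext => n;
  apply: etrans (lift_gen t _) _; rewrite /t.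
- by rewrite odd_double doubleK.
- by rewrite /= odd_double uphalf_double.
Qed.

End FreeMaps.

Section Ract.
Variables (F : fieldType) (H : groupType) (M : lmodType (group_algebra F H)^c).
Implicit Types (a b : M) (f g : group_algebra F H).

Lemma ract0 a : ract a (0 : group_algebra F H) = 0.
Proof. exact: scale0r. Qed.

Lemma ractD a f g : ract a (f + g) = ract a f + ract a g.
Proof. exact: scalerDl. Qed.

Lemma ract0l f : ract (0 : M) f = 0.
Proof. exact: scaler0. Qed.

Lemma ractDl a b f : ract (a + b) f = ract a f + ract b f.
Proof. exact: scalerDr. Qed.

End Ract.

Lemma Forall2_map (I S T : Type) (P : S -> T -> Prop) (f : I -> S) (g : I -> T) s :
  (forall i, P (f i) (g i)) -> List.Forall2 P (map f s) (map g s).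
Proof. by move=> fg; elim: s => //= *; constructor. Qed.

Lemma Forall_map (I S : Type) (P : S -> Prop) (f : I -> S) s :
  (forall i, P (f i)) -> List.Forall P (map f s).
Proof. by move=> fP; elim: s => //= *; constructor. Qed.

Lemma Forall2_nth (S T : Type) (P : S -> T -> Prop) x y s t : P x y ->
  List.Forall2 P s t -> forall i, P (nth x s i) (nth y t i).
Proof. by move=> Pxy; elim=> [|a b {}s {}t Pab _ IHs] [|i] //=. Qed.

Lemma Forall2_size (S T : Type) (P : S -> T -> Prop) s t :
  List.Forall2 P s t -> size s = size t.
Proof. by elim=> //= *; congr _.+1. Qed.

Lemma map_nth_enum (T : Type) (x : T) s n : size s = n ->
  [seq nth x s i | i : 'I_n] = s.
Proof.
move=> <-; rewrite -[RHS](mkseq_nth x) /mkseq -val_enum_ord -map_comp.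
by apply: eq_map.
Qed.

Lemma nth_map_enum (T : Type) (x : T) n (f : 'I_n -> T) (i : 'I_n) :
  nth x [seq f j | j <- enum 'I_n] i = f i.
Proof. by rewrite (nth_map i) ?size_enum_ord // nth_ord_enum. Qed.

(** * The correspondence between varieties and their ideals of identities *)

Section Varieties.
Variable F : fieldType.
Local Notation R := (group_algebra F freeG).
Local Notation vb := (@verbal F R (@ga_inj F freeG)
  (fun (M : lmodType F) (h : freeG -> M) => ga_ext h : {linear R -> M})).
Implicit Types (V U : rep_class F) (I J : set R) (E : group_rep F).

Definition var_of I : rep_class F := fun E => forall f, I f -> satisfies_identity E f.
Definition id_of V : set R := [set f | forall E, V E -> satisfies_identity E f].

Lemma verbal_id_of V : vb (id_of V).
Proof.
split=> [E _ a mu|f g If Ig E VE a mu|f g Ig E VE a mu|f g If E VE a mu|h f If E VE a mu].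
- by rewrite linear0 ract0.
- by rewrite linearD ractD (If E) // (Ig E) // addr0.
- by rewrite rmorphM -ractM (Ig E).
- by rewrite rmorphM -ractM (If E) // ract0l.
- have := If E VE a (fg_lift (fun n => mu (h n))).
  by rewrite -(ga_map_lift mu h f).
Qed.

Lemma var_of_id_of V : is_variety V -> class_eq V (var_of (id_of V)).
Proof.
move=> [I VI] E; split=> [VE f If|VE]; first exact: If.
by apply/VI => f If; apply: VE => E' /VI; apply.
Qed.

Lemma is_variety_var_of I : is_variety (var_of I).
Proof. by exists I. Qed.

Lemma var_ofS I J : I `<=` J -> class_sub (var_of J) (var_of I).
Proof. by move=> IJ E JE f If; apply/JE/IJ. Qed.

Section Quotient.
Variables (K : nzRingType) (M : lmodType K) (N : {pred M}).
Hypothesis closedN : submod_closed N.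
Local Notation Q := (quotient_module closedN).

Lemma pi_quotient_eq0 (a : M) : (\pi_Q%qT a == 0 :> Q) = (a \in N).
Proof.
rewrite -[a in RHS]subr0 -[RHS]/(a - 0 \in submod_pred closedN).
by rewrite Quotient.idealrBE raddf0.
Qed.

End Quotient.

(** The right module [R / I] satisfies the identities in [I] because [I] is verbal; the class of 1,
    under the identity substitution, tests whether [f] lies in [I]. *)
Lemma id_of_var_of I : vb I -> id_of (var_of I) `<=` I.
Proof.
move=> vI f If; pose M : lmodType R^c := (R^c)^o.
pose N : {pred M} := fun a => `[< I a >].
have closedN : submod_closed N.
  split=> [|c u v /asboolP Iu /asboolP Iv]; apply/asboolP.
    exact: (verbal0 vI).
  apply: (verbalD vI) Iv; exact: (verbalMr vI).
pose Q := quotient_module closedN.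
have QE (a : M) (g : R) : ract (\pi_Q%qT a) g = \pi_Q%qT (ract a g).
  exact/esym/pi_qm_scale.
have VI : var_of I (GroupRep (Q : lmodType R^c)).
  move=> g Ig; elim/quotW => a mu; apply: etrans (QE a (ga_map mu g)) _.
  apply/eqP; rewrite pi_quotient_eq0; apply/asboolP; apply: (verbalMl vI).
  rewrite -(ga_map_gen mu g).
  exact: (verbal_map vI (fun n => mu (gen n)) Ig).
have idE : ga_map (fg_lift gen) f = f.
  apply: (@ga_linear_ext F freeG R (ga_map (fg_lift gen)) id) => [||x].
  - exact: linearP.
  - by [].
  apply: etrans (ga_map_inj F (fg_lift gen) x) _; congr (ga_inj F _).
  exact: lift_id.
have := If _ VI (\pi_Q%qT (1 : R)) (fg_lift gen).
move=> /(etrans (esym (QE _ _))) /eqP.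
rewrite pi_quotient_eq0 => /asboolP; rewrite idE.
by rewrite /ract /= -[_ *: _]/((1 : R) * f) mul1r.
Qed.

(** The order reverses for right modules: values of [J] map the module into the submodule, which
    values of [I] then kill. *)
Lemma var_of_iprod I J : vb I -> vb J ->
  class_eq (class_mul (var_of I) (var_of J)) (var_of (iprod J I)).
Proof.
move=> vI vJ E; split.
  move=> [N [closedN [NI NJ]]].
  suff JI : iprod J I `<=` [set f |
      forall (a : rep_module E) (mu : {multiplicative freeG -> rep_group E}),
      ract a (ga_map mu f) = 0].
    by move=> f /JI fP a mu; apply: fP.
  apply: iprod_min => [a mu|f g f0 g0 a mu|j i Jj Ii a mu] /=.
  - by rewrite linear0 ract0.
  - by rewrite linearD ractD f0 g0 addr0.
  rewrite rmorphM -ractM; set b := ract a _.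
  have Nb : b \in N.
    rewrite -(pi_quotient_eq0 closedN); apply/eqP.
    apply: etrans (pi_qm_scale closedN _ a) _.
    exact: (NJ j Jj (\pi_(quotient_module closedN)%qT a) mu).
  pose b' : submodule closedN := exist _ b Nb.
  exact: (congr1 (fun z : submodule closedN => sval z) (NI i Ii b' mu)).
move=> EJI.
(* The elements killed by every value of [I] form the largest submodule lying in [var_of I]. *)
pose N : {pred rep_module E} := fun a =>
  `[< forall f (mu : {multiplicative freeG -> rep_group E}), I f -> ract a (ga_map mu f) = 0 >].
have closedN : submod_closed N.
  split=> [|c u v /asboolP Nu /asboolP Nv]; apply/asboolP => f mu If.
    exact: ract0l.
  rewrite ractDl Nv // addr0 -[c *: u]/(ract u c) ractM.
  elim/ga_ind: c => [|c y r IHr]; first by rewrite mul0r ract0.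
  rewrite mulrDl ractD IHr addr0.
  have [nu nuE] := ga_map_conj F mu y.
  rewrite -scalerAl nuE scalerAr -ractM Nu //; exact: ract0l.
exists N, closedN; split.
  move=> f If a mu; apply: val_inj; have /asboolP := valP a.
  by apply.
move=> f Jf; elim/quotW => a mu.
apply: etrans (esym (pi_qm_scale closedN _ a)) _.
apply/eqP; rewrite pi_quotient_eq0; apply/asboolP => g nu Ig.
(* Values of [f] and [g] under two morphisms multiply to a value of an element of [iprod J I] under
   the single morphism [tau]. *)
have [tau [h [h' [muE nuE]]]] := ga_map_disjoint F mu nu.
rewrite -(muE f) -(nuE g) ractM -rmorphM.
by apply: EJI; apply: iprod_mul; [exact: (verbal_map vJ)|exact: (verbal_map vI)].
Qed.

Lemma class_mulS U U' V V' : class_sub U U' -> class_sub V V' ->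
  class_sub (class_mul U V) (class_mul U' V').
Proof.
by move=> UU VV E [N [closedN [NU NV]]]; exists N, closedN; split; [apply: UU|apply: VV].
Qed.

Lemma class_prodlS s s' : List.Forall2 (@class_sub F) s s' ->
  class_sub (class_prodl s) (class_prodl s').
Proof.
elim=> [|U U' {}s {}s' UU ss' IHs] //.
by case: ss' IHs => [|V V' {}s {}s' VV ss'] IHs //; apply: class_mulS.
Qed.

Lemma verbal_rprod_ga s : List.Forall (fun I => vb I) s -> vb (rprod s).
Proof.
apply: verbal_rprod; [exact: ga_injM|exact: ga_ind|exact: ga_ext_inj].
Qed.

Lemma var_of_setT : class_eq (@zero_class F) (var_of setT).
Proof.
move=> E; split=> [E0 f _ a mu|ET a]; first exact: E0.
have := ET 1 Logic.I a (fg_lift (fun=> 1%g)).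
by rewrite rmorph1 => /(etrans (esym (scale1r a))).
Qed.

Lemma class_prodl_var_of s : List.Forall (fun I => vb I) s ->
  class_eq (class_prodl (map var_of s)) (var_of (rprod s)).
Proof.
elim=> [|I {}s vI vs IHs]; first exact: var_of_setT.
(* [class_prodl] treats a singleton apart, whereas [rprod] multiplies it by the whole ring. *)
case: vs IHs => [|J s' vJ vs'] IHs E.
  by rewrite /= (iprodTl vI).
apply: (iff_trans _ (var_of_iprod vI (verbal_rprod_ga (List.Forall_cons _ vJ vs')) E)).
by split; apply: class_mulS => // E' /IHs.
Qed.

Lemma class_prod_id_of n (V : 'I_n -> rep_class F) : (forall i, is_variety (V i)) ->
  class_eq (class_prod V) (var_of (rprod [seq id_of (V i) | i <- enum 'I_n])).
Proof.
move=> varV E; have vI : List.Forall (fun P => vb P) [seq id_of (V i) | i <- enum 'I_n].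
  by apply: Forall_map => i; apply: verbal_id_of.
apply: (iff_trans _ (class_prodl_var_of vI E)); rewrite /class_prod -map_comp.
by split; apply: class_prodlS; apply: Forall2_map => i E'; case: (var_of_id_of (varV i) E').
Qed.

Lemma class_prod_var_of n s : size s = n -> List.Forall (fun P => vb P) s ->
  class_eq (class_prod (fun i : 'I_n => var_of (nth setT s i))) (var_of (rprod s)).
Proof.
move=> szs vs E; apply: (iff_trans _ (class_prodl_var_of vs E)).
by rewrite -{2}(map_nth_enum setT szs) -map_comp.
Qed.

(** * Refinement for products of varieties *)

Lemma refinement (k l : nat) (V : 'I_k -> rep_class F) (V' : 'I_l -> rep_class F) :
  (forall i, is_variety (V i)) -> (forall j, is_variety (V' j)) ->
  class_sub (class_prod V) (class_prod V') ->
  exists (W : rep_class F) (Ws : 'I_k -> rep_class F) (Ws' : 'I_l -> rep_class F),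
    [/\ is_variety W, forall i, is_variety (Ws i) & forall j, is_variety (Ws' j)] /\
    [/\ class_eq W (class_prod Ws), class_eq W (class_prod Ws'),
        forall i, class_sub (V i) (Ws i) & forall j, class_sub (Ws' j) (V' j)].
Proof.
move=> varV varV' VV'.
pose Is := [seq id_of (V i) | i <- enum 'I_k].
pose Js := [seq id_of (V' j) | j <- enum 'I_l].
have vIs : List.Forall (fun P => vb P) Is by apply: Forall_map => i; apply: verbal_id_of.
have vJs : List.Forall (fun P => vb P) Js by apply: Forall_map => i; apply: verbal_id_of.
have JI : rprod Js `<=` rprod Is.
  (* Elements of [rprod Js] are identities of the product of the [V' j], hence of that of the [V i],
     whose identities lie in [rprod Is]. *)
  apply: subset_trans (id_of_var_of (verbal_rprod_ga vIs)) => f Jf E.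
  by move=> /(class_prod_id_of varV E)/VV'/(class_prod_id_of varV' E); apply.
have [As [Bs [vAs vBs AB AIs JBs]]] := verbal_refinement (erefl : ga_inj F 1%g = 1)
  (@ga_injM F freeG) (@ga_ind F freeG) (@ga_ext_inj F freeG) vIs vJs JI.
have szA : size As = k by rewrite (Forall2_size AIs) size_map size_enum_ord.
have szB : size Bs = l by rewrite -(Forall2_size JBs) size_map size_enum_ord.
exists (var_of (rprod As)), (fun i => var_of (nth setT As i)),
  (fun j => var_of (nth setT Bs j)).
split; first by split=> *; apply: is_variety_var_of.
split=> [||i|j].
- by move=> E; apply: iff_sym; apply: class_prod_var_of.
- by move=> E; rewrite AB; apply: iff_sym; apply: class_prod_var_of.
- move=> E /(var_of_id_of (varV i)); apply: var_ofS.
  (* [Forall2_nth] covers all positions, so the defaults [setT] have to be related as well. *)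
  by have := Forall2_nth (@subsetT _ setT) AIs i; rewrite nth_map_enum.
- move=> E BE; apply/(var_of_id_of (varV' j)); move: E BE; apply: var_ofS.
  by have := Forall2_nth (@subsetT _ setT) JBs j; rewrite nth_map_enum.
Qed.

End Varieties.

Local Close Scope classical_set_scope.
Local Close Scope ring_scope.

Theorem theorem1p2 (F : fieldType) (k l : nat) (hk : 0 < k) (hl : 0 < l)
  (V : 'I_k -> rep_class F) (V' : 'I_l -> rep_class F)
  (varV : forall i, is_variety (V i)) (varV' : forall j, is_variety (V' j)) :
  class_sub (class_prod V) (class_prod V') <->
  exists (W : rep_class F) (Ws : 'I_k -> rep_class F) (Ws' : 'I_l -> rep_class F),
    [/\ is_variety W, forall i, is_variety (Ws i) & forall j, is_variety (Ws' j)] /\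
    [/\ class_eq W (class_prod Ws), class_eq W (class_prod Ws'),
        forall i, class_sub (V i) (Ws i) & forall j, class_sub (Ws' j) (V' j)].
Proof.
split; first exact: refinement.
move=> [W [Ws [Ws' [_ [WE WE' VW WV]]]]] E VE.
(* Products are monotone in each factor, which gives the chain from [V] through [Ws], [W] and [Ws']
   to [V']. *)
apply: (class_prodlS (Forall2_map _ WV)); apply/WE'/WE.
exact: (class_prodlS (Forall2_map _ VW)).
Qed.
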